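(* For each $\lambda\in\mathbb{R}$, there exists in the Heisenberg space $\mathrm{Nil}_3$ a one-parameter family of $\lambda$-grim reapers, parametrized by the tilting. The profile curve of a $\lambda$-grim reaper lies in a vertical plane, loops and self-intersects infinitely many times.
   Context: The Heisenberg space $\mathrm{Nil}_3$ is $\mathbb{R}^3$ with coordinates $(x,y,z)$ and metric $\langle\cdot,\cdot\rangle=dx^2+dy^2+(dz+\tau(y\,dx-x\,dy))^2$, where $\tau$ is a fixed constant. It is a Lie group with product $(x_1,y_1,z_1)*(x_2,y_2,z_2)=(x_1+x_2,\,y_1+y_2,\,z_1+z_2+\tau(x_1y_2-x_2y_1))$, and the left-translations $L_p(q)=p*q$ are isometries; vertical translations are the left-translations $(x,y,z)\mapsto(x,y,z+t)$. The mean curvature $H$ is half the trace of the second fundamental form with respect to the unit normal $N$. Given $\lambda\in\mathbb{R}$, an oriented surface $M$ in $\mathrm{Nil}_3$ is a $\lambda$-translator if $H(p)=\langle N(p),\partial_z\rangle+\lambda$ for all $p\in M$. A $\lambda$-grim reaper is a $\lambda$-translator invariant under a one-parameter group of non-vertical left-translations. After a rotation about a vertical axis, it is parametrized as $\psi(s,t)=L_{(0,t,ct)}(\alpha(s))=(x(s),\,t,\,-\tau t\,x(s)+z(s)+ct)$, where $\alpha(s)=(x(s),0,z(s))$ is its profile (base) curve, contained in the vertical plane $\{y=0\}$, and the parameter $c\geq 0$ is the tilting.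
   Formalization: Infinitely many loops and self-intersections are claimed only for λ ≠ 0 (for λ = 0 profiles are vertical lines or graphs, e.g. a vertical plane, so the claim fails); τ ≠ 0 is assumed, and grim reapers are taken complete, with profile parametrized by arc length on the whole line. *)

(* Defs.v *)
From Stdlib Require Import Reals.
From Coquelicot Require Import Coquelicot.

Open Scope R_scope.

(* Points of Nil_3, and tangent vectors in the coordinate basis, are triples
   of coordinates (x, y, z). *)
Definition R3 : Type := (R * R * R)%type.

Definition cx (p : R3) : R := fst (fst p).
Definition cy (p : R3) : R := snd (fst p).
Definition cz (p : R3) : R := snd p.

Definition add3 (p q : R3) : R3 := (cx p + cx q, cy p + cy q, cz p + cz q).
Definition scal3 (a : R) (p : R3) : R3 := (a * cx p, a * cy p, a * cz p).

Inductive axis : Set := axis_x | axis_y | axis_z.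

Definition coord (i : axis) (p : R3) : R :=
  match i with
  | axis_x => cx p
  | axis_y => cy p
  | axis_z => cz p
  end.

(* The coordinate fields; basis axis_z is d/dz. *)
Definition basis (i : axis) : R3 :=
  match i with
  | axis_x => (1, 0, 0)
  | axis_y => (0, 1, 0)
  | axis_z => (0, 0, 1)
  end.

Definition sum_axes (f : axis -> R) : R := f axis_x + f axis_y + f axis_z.

(** * The Heisenberg space *)

Definition nil_mul (tau : R) (p q : R3) : R3 :=
  (cx p + cx q, cy p + cy q, cz p + cz q + tau * (cx p * cy q - cx q * cy p)).

Definition left_translation (tau : R) (p : R3) : R3 -> R3 := nil_mul tau p.

(* dx^2 + dy^2 + (dz + tau (y dx - x dy))^2 at the point p *)
Definition metric (tau : R) (p v w : R3) : R :=
  cx v * cx w + cy v * cy w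
  + (cz v + tau * (cy p * cx v - cx p * cy v))
    * (cz w + tau * (cy p * cx w - cx p * cy w)).

Definition metric_coef (tau : R) (i j : axis) (p : R3) : R :=
  metric tau p (basis i) (basis j).

Definition partial (i : axis) (f : R3 -> R) (p : R3) : R :=
  Derive (fun h => f (add3 p (scal3 h (basis i)))) 0.

(* Christoffel symbols of the first kind,
   christoffel tau l a b = < nabla_{d_a} d_b , d_l >. *)
Definition christoffel (tau : R) (l a b : axis) (p : R3) : R :=
  (partial a (metric_coef tau l b) p + partial b (metric_coef tau l a) p
   - partial l (metric_coef tau a b) p) / 2.

(** * Immersed surfaces, parametrized on the plane *)

Definition surface : Type := R -> R -> R3.

Definition d_s (psi : surface) : surface := fun s t =>
  (Derive (fun r => cx (psi r t)) s,
   Derive (fun r => cy (psi r t)) s,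
   Derive (fun r => cz (psi r t)) s).

Definition d_t (psi : surface) : surface := fun s t =>
  (Derive (fun r => cx (psi s r)) t,
   Derive (fun r => cy (psi s r)) t,
   Derive (fun r => cz (psi s r)) t).

Definition smooth_surface (psi : surface) : Prop :=
  forall (i : axis) (n : nat) (s t : R),
    ex_diff_n (fun u v => coord i (psi u v)) n s t.

Definition immersion (psi : surface) : Prop :=
  forall s t a b : R,
    add3 (scal3 a (d_s psi s t)) (scal3 b (d_t psi s t)) = (0, 0, 0) ->
    a = 0 /\ b = 0.

(* N s t is a tangent vector of Nil_3 at psi s t.  Continuity makes N an
   orientation of the surface. *)
Definition unit_normal (tau : R) (psi N : surface) : Prop :=
  (forall i s t, continuity_2d_pt (fun u v => coord i (N u v)) s t) /\
  forall s t : R,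
    metric tau (psi s t) (N s t) (N s t) = 1 /\
    metric tau (psi s t) (N s t) (d_s psi s t) = 0 /\
    metric tau (psi s t) (N s t) (d_t psi s t) = 0.

(* < nabla_V W , N > along psi, where V and W are coordinate fields of the
   surface and dVW is the coordinatewise derivative of W in the direction V. *)
Definition second_form (tau : R) (p V W dVW N : R3) : R :=
  metric tau p dVW N
  + sum_axes (fun l => coord l N *
      sum_axes (fun a => sum_axes (fun b =>
        christoffel tau l a b p * coord a V * coord b W))).

(* Half the trace, with respect to the induced metric, of the second
   fundamental form. *)
Definition mean_curvature (tau : R) (psi N : surface) (s t : R) : R :=
  let p := psi s t in
  let Vs := d_s psi s t in
  let Vt := d_t psi s t in
  let E := metric tau p Vs Vs in
  let F := metric tau p Vs Vt in
  let G := metric tau p Vt Vt in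
  let e := second_form tau p Vs Vs (d_s (d_s psi) s t) (N s t) in
  let f := second_form tau p Vs Vt (d_s (d_t psi) s t) (N s t) in
  let g := second_form tau p Vt Vt (d_t (d_t psi) s t) (N s t) in
  (e * G - 2 * f * F + g * E) / (E * G - F * F) / 2.

Definition angle_function (tau : R) (psi N : surface) (s t : R) : R :=
  metric tau (psi s t) (N s t) (basis axis_z).

Definition translator (tau lambda : R) (psi N : surface) : Prop :=
  smooth_surface psi /\ immersion psi /\ unit_normal tau psi N /\
  forall s t : R,
    mean_curvature tau psi N s t = angle_function tau psi N s t + lambda.

(** * Grim reapers *)

Definition tilted_line (c r : R) : R3 := (0, r, c * r).

(* The group of the left-translations by tilted_line c r acts on the surface
   by translation of the second parameter. *)
Definition tilt_invariant (tau c : R) (psi : surface) : Prop :=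
  forall s t r : R,
    psi s (t + r) = left_translation tau (tilted_line c r) (psi s t).

(* For an invariant surface, psi s t has second coordinate cy (psi s 0) + t, so
   this is the point at which the orbit psi s _ crosses the plane y = 0. *)
Definition profile_curve (psi : surface) : R -> R3 :=
  fun s => psi s (- cy (psi s 0)).

Definition velocity (alpha : R -> R3) (s : R) : R3 :=
  (Derive (fun r => cx (alpha r)) s,
   Derive (fun r => cy (alpha r)) s,
   Derive (fun r => cz (alpha r)) s).

Definition unit_speed (tau : R) (alpha : R -> R3) : Prop :=
  forall s : R, metric tau (alpha s) (velocity alpha s) (velocity alpha s) = 1.

(* Asking for an arc-length parameter that runs over all of R makes the surface
   complete; a small piece of a grim reaper need not have any loop. *)
Definition grim_reaper (tau lambda c : R) (psi N : surface) : Prop :=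
  translator tau lambda psi N /\ tilt_invariant tau c psi /\
  unit_speed tau (profile_curve psi).

(** * Loops and self-intersections of a curve *)

Definition is_loop (alpha : R -> R3) (a b : R) : Prop :=
  a < b /\ alpha a = alpha b /\
  forall s s' : R, a <= s < b -> a <= s' < b -> alpha s = alpha s' -> s = s'.

(* Infinitely many loops, with pairwise disjoint parameter intervals. *)
Definition loops_infinitely_often (alpha : R -> R3) : Prop :=
  exists a b : nat -> R, forall n : nat,
    is_loop alpha (a n) (b n) /\ b n < a (S n).

Definition self_intersection (alpha : R -> R3) (p : R3) : Prop :=
  exists s s' : R, s <> s' /\ alpha s = p /\ alpha s' = p.

Definition self_intersects_infinitely_often (alpha : R -> R3) : Prop :=
  exists p : nat -> R3,
    (forall m n : nat, p m = p n -> m = n) /\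
    forall n : nat, self_intersection alpha (p n).

(* Main.v *)
Require Import Defs.
From Stdlib Require Import Reals Lra Lia Psatz Classical IndefiniteDescription.
From Coquelicot Require Import Coquelicot.

Open Scope R_scope.

(* Along a unit-speed profile (x, z) put w = c - 2 tau x, W = sqrt (1 + w^2 x'^2) and
   let k be the curvature.  Replacing N by -N changes the sign of lambda, so assume
   that N points to the side of (-z', x').  The translator equation is then
     k (1 + w^2) + 2 tau w z' x'^2 = 2 W^2 (x' + lambda W).
   Existence: with x' = cos q and z' = sin q this is a system in (w, q) that does not
   contain c, and |w'| <= 2 |tau| keeps the Picard iterates in a region where the
   system is Lipschitz, so that the solution is global.
   Loops: the equation says that S = z'/W, a number in [-1, 1], satisfies
   S' = 2 x' (x'/W + lambda).  The reflection x -> -x allows lambda > 0.  Then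
     Q = S - 2 lambda x,   Q' = 2 x'^2 / W,
   is increasing, and unbounded.  The curve has infinitely many vertical points; at
   each of them q increases, so that z' is alternately 1 and -1 there.  Since Q
   increases, x decreases from one vertical point with z' = 1 to the next, and
   likewise for z' = -1.  Three consecutive arcs between vertical points are thus
   graphs over overlapping intervals of the x-axis, and they must cross.  Finally
   Q -> oo forces x -> -oo, so the crossings give infinitely many points. *)

(** * Calculus and topology of the line *)

(** [S] is minus the x-component of the unit normal in the left-invariant orthonormal frame, and 1 -
    S^2 = x'^2 (1 + w^2) / W^2, so that |S| = 1 exactly at the vertical points. The obstacle is that
    S' and Q' both vanish with x': near a vertical direction neither gives a rate, and a priori the
    curve could turn towards the vertical for ever. Two substitutes for [S] remove the degeneracy
    while w is bounded. The derivative of arcsin S has the factor x' divided out, which bounds the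
    length of an arc on which x' keeps its sign. The derivative of S - S^3/3 has two further factors
    x', which makes it comparable with Q'. When w is not bounded, x'/W is small and S' is dominated
    by 2 lambda x'. This is where tau <> 0 enters the study of loops: it makes |w| large when |x| is
    large. *)

Lemma nondecreasing_of_derive (f df : R -> R) (a b : R) :
  a <= b -> (forall r, a <= r <= b -> is_derive f r (df r)) ->
  (forall r, a <= r <= b -> 0 <= df r) -> f a <= f b.
Proof.
intros Hab Hd Hp.
destruct (MVT_gen f a b df) as [c [Hc Hv]];
  rewrite ?Rmin_left, ?Rmax_right in * by lra.
- intros x Hx; apply Hd; lra.
- intros x Hx; apply continuity_pt_filterlim.
  apply (ex_derive_continuous (V := R_NormedModule)).
  exists (df x); apply Hd; lra.
- assert (0 <= df c * (b - a)) by (apply Rmult_le_pos; [apply Hp | ]; lra).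
  lra.
Qed.

Lemma increasing_of_derive (f df : R -> R) (a b : R) :
  a < b -> (forall r, a <= r <= b -> is_derive f r (df r)) ->
  (forall r, a < r < b -> 0 < df r) -> f a < f b.
Proof.
intros Hab Hd Hp.
destruct (MVT_cor2 f df a b Hab) as [c [Hv Hc]].
- intros x Hx; apply is_derive_Reals; auto.
- assert (0 < df c * (b - a)) by (apply Rmult_lt_0_compat; [apply Hp | ]; lra).
  lra.
Qed.

Lemma is_derive_continuity (f : R -> R) (x l : R) :
  is_derive f x l -> continuity_pt f x.
Proof.
intros H; apply continuity_pt_filterlim.
apply (ex_derive_continuous (V := R_NormedModule)); now exists l.
Qed.

(* [auto_derive], with the derivatives of unknown functions read off the
   hypotheses that [tac] solves. *)
Ltac derive_with tac :=
  auto_derive;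
  [ repeat split; try (eexists; tac) 
  | repeat match goal with
    | |- context [Derive ?f ?x] =>
        erewrite (is_derive_unique f x) by tac
    end ].

Lemma continuity_pt_eps (f : R -> R) (x e : R) :
  continuity_pt f x -> 0 < e ->
  exists d, 0 < d /\ forall y, Rabs (y - x) < d -> Rabs (f y - f x) < e.
Proof.
intros Hf He. apply continuity_pt_filterlim in Hf.
apply filterlim_locally with (eps := mkposreal e He) in Hf.
destruct Hf as [d Hd]. exists d. split; [apply cond_pos | exact Hd].
Qed.

Lemma IVT_zero (f : R -> R) (a b : R) :
  continuity f -> a <= b -> 0 < f a -> f b < 0 -> exists r, a <= r <= b /\ f r = 0.
Proof.
intros Hf Hab Ha Hb. destruct (IVT_cor f a b Hf Hab) as [r Hr].
- nra.
- now exists r.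
Qed.

(** The zero is the supremum of the points up to which [f] stays positive; continuity excludes a
    positive value there, which would extend the set, and a negative one, which would show up
    slightly before. *)
Lemma first_zero (f : R -> R) (a t : R) :
  continuity f -> a < t -> 0 < f a -> f t = 0 ->
  exists r, a < r <= t /\ f r = 0 /\ forall y, a <= y < r -> 0 < f y.
Proof.
intros Hf Hat Ha Ht.
set (E := fun y => a <= y /\ forall u, a <= u <= y -> 0 < f u).
assert (Hub : forall y, E y -> y < t).
{ intros y [Hy H]. apply Rnot_le_lt. intros Hty. specialize (H t). lra. }
destruct (completeness E) as [r [Hr1 Hr2]].
- exists t. intros y Hy. left. now apply Hub.
- exists a. split; [lra | ]. intros u Hu. now replace u with a by lra.
- assert (Har : a <= r).
  { apply Hr1. split; [lra | ]. intros u Hu. now replace u with a by lra. }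
  assert (Hrt : r <= t) by (apply Hr2; intros y Hy; left; now apply Hub).
  assert (Hpos : forall y, a <= y < r -> 0 < f y).
  { intros y Hy. apply NNPP. intros Hn.
    assert (Hy' : r <= y); [ | lra].
    apply Hr2. intros v [Hv1 Hv2]. apply Rnot_lt_le. intros Hyv. apply Hn, Hv2. lra. }
  assert (Hn : ~ 0 < f r).
  { intros Hfr. destruct (continuity_pt_eps f r (f r) (Hf r) Hfr) as [d [Hd Hd']].
    assert (Hc : r + d / 2 <= r); [ | lra].
    apply Hr1. split; [lra | ]. intros u Hu.
    destruct (Rlt_dec u r) as [Hur | Hur]; [apply Hpos; lra | ].
    assert (H : Rabs (f u - f r) < f r) by (apply Hd', Rabs_def1; lra).
    apply Rabs_def2 in H. lra. }
  assert (Har' : a < r).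
  { destruct Har as [H | H]; [exact H | ]. subst r. contradiction. }
  exists r. repeat split; try lra.
  + apply Rle_antisym; [lra | ]. apply Rnot_lt_le. intros Hfr.
    destruct (continuity_pt_eps f r (- f r) (Hf r)) as [d [Hd Hd']]; [lra | ].
    assert (Hm := Rmax_l a (r - d / 2)). assert (Hm' := Rmax_r a (r - d / 2)).
    assert (Hm2 : Rmax a (r - d / 2) < r) by (apply Rmax_lub_lt; lra).
    assert (H1 : 0 < f (Rmax a (r - d / 2))) by (apply Hpos; lra).
    assert (H2 : Rabs (f (Rmax a (r - d / 2)) - f r) < - f r)
      by (apply Hd', Rabs_def1; lra).
    apply Rabs_def2 in H2. lra.
  + exact Hpos.
Qed.

Lemma is_derive_pos_local (f : R -> R) (r l : R) :
  is_derive f r l -> 0 < l ->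
  exists d, 0 < d /\ (forall y, r < y < r + d -> f r < f y) /\
    (forall y, r - d < y < r -> f y < f r).
Proof.
intros Hd Hl. apply is_derive_Reals in Hd.
destruct (Hd l Hl) as [d H]. exists d. split; [apply cond_pos | split].
- intros y Hy. specialize (H (y - r)).
  replace (r + (y - r)) with y in H by ring.
  assert (H' : Rabs ((f y - f r) / (y - r) - l) < l)
    by (apply H; [lra | apply Rabs_def1; lra]).
  apply Rabs_def2 in H'.
  assert (0 < (f y - f r) / (y - r)) by lra.
  assert (0 < (f y - f r) / (y - r) * (y - r)) by (apply Rmult_lt_0_compat; lra).
  replace ((f y - f r) / (y - r) * (y - r)) with (f y - f r) in * by (field; lra). lra.
- intros y Hy. specialize (H (y - r)).
  replace (r + (y - r)) with y in H by ring.
  assert (H' : Rabs ((f y - f r) / (y - r) - l) < l)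
    by (apply H; [lra | apply Rabs_def1; lra]).
  apply Rabs_def2 in H'.
  assert (0 < (f y - f r) / (y - r)) by lra.
  assert (0 < (f y - f r) / (y - r) * (r - y)) by (apply Rmult_lt_0_compat; lra).
  replace ((f y - f r) / (y - r) * (r - y)) with (- (f y - f r)) in * by (field; lra). lra.
Qed.

(** The inverse is precomposed with the projection onto [X a, X b], so that it is continuous on the
    whole line, as the intermediate value theorem is used for globally continuous functions. *)
Lemma increasing_inverse (X : R -> R) (a b : R) :
  a < b -> continuity X -> (forall s t, a <= s -> s < t -> t <= b -> X s < X t) ->
  exists Y : R -> R, continuity Y /\
    forall v, X a <= v <= X b -> a <= Y v <= b /\ X (Y v) = v.
Proof.
intros Hab HX Hinc.
assert (HXab : X a < X b) by (apply Hinc; lra).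
set (clamp := fun v => Rmax (X a) (Rmin (X b) v)).
assert (Hcl : forall v, X a <= clamp v <= X b).
{ intros v. unfold clamp. split; [apply Rmax_l | ].
  apply Rmax_lub; [lra | apply Rmin_l]. }
assert (Hlip : forall v v', Rabs (clamp v - clamp v') <= Rabs (v - v')).
{ intros v v'. unfold clamp, Rmax, Rmin.
  repeat destruct Rle_dec; unfold Rabs; repeat destruct Rcase_abs; lra. }
destruct (functional_choice (fun v y => a <= y <= b /\ X y = clamp v)) as [Y HY].
{ intros v. destruct (IVT_gen X a b (clamp v) HX) as [y [Hy Hv]].
  - rewrite Rmin_left, Rmax_right by lra. apply Hcl.
  - exists y. rewrite Rmin_left, Rmax_right in Hy by lra. tauto. }
exists Y. split.
- intros v0. apply continuity_pt_filterlim, filterlim_locally. intros e.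
  destruct (HY v0) as [H0 E0]. assert (He := cond_pos e).
  (* If Y v0 - e lies to the left of a, any radius will do, as [Y] takes its values in [a, b].
     Otherwise the radius is the gap between the values of [X] at Y v0 - e and at Y v0; the upper
     bound [U] is symmetric. *)
  assert (L : exists d, 0 < d /\ forall v, Rabs (v - v0) < d -> Y v0 - e < Y v).
  { destruct (Rlt_dec (Y v0 - e) a) as [Hl | Hl].
    - exists 1. split; [lra | ]. intros v _. destruct (HY v). lra.
    - exists (clamp v0 - X (Y v0 - e)). split.
      + rewrite <- E0. assert (X (Y v0 - e) < X (Y v0)) by (apply Hinc; lra). lra.
      + intros v Hv. apply Rnot_le_lt. intros Hle.
        destruct (HY v) as [H1 E1].
        assert (X (Y v) <= X (Y v0 - e)).
        { destruct Hle as [Hle | Hle]; [left; apply Hinc; lra | rewrite Hle; lra]. }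
        assert (H2 := Hlip v v0).
        assert (H3 : Rabs (clamp v - clamp v0) < clamp v0 - X (Y v0 - e)) by lra.
        apply Rabs_def2 in H3. lra. }
  assert (U : exists d, 0 < d /\ forall v, Rabs (v - v0) < d -> Y v < Y v0 + e).
  { destruct (Rlt_dec b (Y v0 + e)) as [Hl | Hl].
    - exists 1. split; [lra | ]. intros v _. destruct (HY v). lra.
    - exists (X (Y v0 + e) - clamp v0). split.
      + rewrite <- E0. assert (X (Y v0) < X (Y v0 + e)) by (apply Hinc; lra). lra.
      + intros v Hv. apply Rnot_le_lt. intros Hle.
        destruct (HY v) as [H1 E1].
        assert (X (Y v0 + e) <= X (Y v)).
        { destruct Hle as [Hle | Hle]; [left; apply Hinc; lra | rewrite Hle; lra]. }
        assert (H2 := Hlip v v0).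
        assert (H3 : Rabs (clamp v - clamp v0) < X (Y v0 + e) - clamp v0) by lra.
        apply Rabs_def2 in H3. lra. }
  destruct L as [d1 [Hd1 L]]. destruct U as [d2 [Hd2 U]].
  exists (mkposreal _ (Rmin_pos _ _ Hd1 Hd2)). intros v Hv.
  change (Rabs (v - v0) < Rmin d1 d2) in Hv. change (Rabs (Y v - Y v0) < e).
  assert (Hm1 := Rmin_l d1 d2). assert (Hm2 := Rmin_r d1 d2).
  specialize (L v). specialize (U v). apply Rabs_def1; lra.
- intros v Hv. destruct (HY v) as [H1 E1]. split; [exact H1 | ].
  rewrite E1. unfold clamp. rewrite Rmin_right, Rmax_right; lra.
Qed.

(* The three monotone arcs are graphs over the X-axis; [rho1 t] and [rho3 t] are the
   points of the outer two above the point [t] of the middle one.  If the middle arc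
   meets neither of them it stays below both, so the outer two exchange their
   order between the two turning points. *)
Lemma zigzag_crossing (X Z : R -> R) (s1 s2 s3 s4 l2 l3 : R) :
  s1 < s2 < s3 -> s3 < s4 -> continuity X -> continuity Z ->
  (forall s t, s1 <= s -> s < t -> t <= s2 -> X s < X t) ->
  (forall s t, s2 <= s -> s < t -> t <= s3 -> X t < X s) ->
  (forall s t, s3 <= s -> s < t -> t <= s4 -> X s < X t) ->
  X s1 < X s3 -> X s2 < X s4 ->
  is_derive Z s2 l2 -> l2 < 0 -> is_derive Z s3 l3 -> 0 < l3 ->
  exists a b, s1 <= a /\ a < b /\ b <= s4 /\ X a = X b /\ Z a = Z b.
Proof.
intros H12 H34 HX HZ Hinc1 Hdec Hinc3 H13 H24 HD2 Hl2 HD3 Hl3.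
destruct (increasing_inverse X s1 s2) as [Y1 [CY1 HY1]]; [lra | assumption | assumption | ].
destruct (increasing_inverse X s3 s4) as [Y3 [CY3 HY3]]; [lra | assumption | assumption | ].
set (rho1 := fun t => Y1 (X t)). set (rho3 := fun t => Y3 (X t)).
assert (C1 : continuity rho1) by (exact (continuity_comp X Y1 HX CY1)).
assert (C3 : continuity rho3) by (exact (continuity_comp X Y3 HX CY3)).
assert (HXt : forall t, s2 <= t <= s3 -> X s3 <= X t <= X s2).
{ intros t Ht. split.
  - destruct (Req_dec t s3) as [E | E]; [subst; lra | left; apply Hdec; lra].
  - destruct (Req_dec t s2) as [E | E]; [subst; lra | left; apply Hdec; lra]. }
assert (R1 : forall t, s2 <= t <= s3 -> s1 <= rho1 t <= s2 /\ X (rho1 t) = X t).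
{ intros t Ht. specialize (HXt t Ht). apply HY1. lra. }
assert (R3 : forall t, s2 <= t <= s3 -> s3 <= rho3 t <= s4 /\ X (rho3 t) = X t).
{ intros t Ht. specialize (HXt t Ht). apply HY3. lra. }
assert (E1 : rho1 s2 = s2).
{ destruct (R1 s2) as [Hr E]; [lra | ].
  apply NNPP. intros Hn. assert (X (rho1 s2) < X s2) by (apply Hinc1; lra). lra. }
assert (E3 : rho3 s3 = s3).
{ destruct (R3 s3) as [Hr E]; [lra | ].
  apply NNPP. intros Hn. assert (X s3 < X (rho3 s3)) by (apply Hinc3; lra). lra. }
apply NNPP. intros Hno.
assert (Hcross : forall a b, s1 <= a -> a < b -> b <= s4 -> X a = X b -> Z a <> Z b).
{ intros a b Ha Hab Hb HXab HZab. apply Hno. exists a, b. auto. }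
(* [Z] decreases through s2, so that just after s2 the middle arc is below the first one. A change
   of sign before s3 would be a crossing. [HG] is the same argument run backwards from s3 with the
   third arc. *)
assert (HF : 0 < Z (rho1 s3) - Z s3).
{ assert (HN : is_derive (fun s => - Z s) s2 (- l2))
    by (apply (is_derive_opp (V := R_NormedModule)), HD2).
  destruct (is_derive_pos_local _ _ _ HN) as [d [Hd [Hr Hl]]]; [lra | ].
  destruct (continuity_pt_eps rho1 s2 d (C1 s2) Hd) as [d' [Hd' Hc]].
  set (t := s2 + Rmin (Rmin d d') (s3 - s2) / 2).
  assert (Hm : 0 < Rmin (Rmin d d') (s3 - s2)) by (repeat apply Rmin_pos; lra).
  assert (Hm1 := Rmin_l (Rmin d d') (s3 - s2)). assert (Hm2 := Rmin_r (Rmin d d') (s3 - s2)).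
  assert (Hm3 := Rmin_l d d'). assert (Hm4 := Rmin_r d d').
  assert (Ht : s2 < t < s3) by (unfold t; lra).
  assert (Hcl : Rabs (rho1 t - rho1 s2) < d)
    by (apply Hc, Rabs_def1; unfold t; lra).
  rewrite E1 in Hcl. apply Rabs_def2 in Hcl.
  destruct (R1 t) as [Hr1 Hr2]; [lra | ].
  assert (Hne : rho1 t <> s2).
  { intros E. rewrite E in Hr2. assert (X t < X s2) by (apply Hdec; lra). lra. }
  assert (Hpos : 0 < Z (rho1 t) - Z t).
  { assert (- Z s2 < - Z t) by (apply Hr; unfold t; lra).
    assert (- Z (rho1 t) < - Z s2) by (apply Hl; lra). lra. }
  apply NNPP. intros Hn.
  assert (Hne3 : Z (rho1 s3) <> Z s3).
  { destruct (R1 s3) as [Hq1 Hq2]; [lra | ]. apply Hcross; lra. }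
  destruct (IVT_zero (fun t => Z (rho1 t) - Z t) t s3) as [r [Hr0 Hz]]; try lra.
  - apply (continuity_minus (fun t => Z (rho1 t)) Z); [ | exact HZ].
    exact (continuity_comp rho1 Z C1 HZ).
  - destruct (R1 r) as [Hq1 Hq2]; [lra | ].
    apply (Hcross (rho1 r) r); lra. }
assert (HG : 0 < Z (rho3 s2) - Z s2).
{ destruct (is_derive_pos_local _ _ _ HD3 Hl3) as [d [Hd [Hr Hl]]].
  destruct (continuity_pt_eps rho3 s3 d (C3 s3) Hd) as [d' [Hd' Hc]].
  set (t := s3 - Rmin (Rmin d d') (s3 - s2) / 2).
  assert (Hm : 0 < Rmin (Rmin d d') (s3 - s2)) by (repeat apply Rmin_pos; lra).
  assert (Hm1 := Rmin_l (Rmin d d') (s3 - s2)). assert (Hm2 := Rmin_r (Rmin d d') (s3 - s2)).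
  assert (Hm3 := Rmin_l d d'). assert (Hm4 := Rmin_r d d').
  assert (Ht : s2 < t < s3) by (unfold t; lra).
  assert (Hcl : Rabs (rho3 t - rho3 s3) < d)
    by (apply Hc, Rabs_def1; unfold t; lra).
  rewrite E3 in Hcl. apply Rabs_def2 in Hcl.
  destruct (R3 t) as [Hr1 Hr2]; [lra | ].
  assert (Hne : rho3 t <> s3).
  { intros E. rewrite E in Hr2. assert (X s3 < X t) by (apply Hdec; lra). lra. }
  assert (Hpos : 0 < Z (rho3 t) - Z t).
  { assert (Z t < Z s3) by (apply Hl; unfold t; lra).
    assert (Z s3 < Z (rho3 t)) by (apply Hr; lra). lra. }
  apply NNPP. intros Hn.
  assert (Hne2 : Z s2 <> Z (rho3 s2)).
  { destruct (R3 s2) as [Hq1 Hq2]; [lra | ]. apply Hcross; lra. }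
  destruct (IVT_zero (fun t => Z t - Z (rho3 t)) s2 t) as [r [Hr0 Hz]]; try lra.
  - apply (continuity_minus Z (fun t => Z (rho3 t))); [exact HZ | ].
    exact (continuity_comp rho3 Z C3 HZ).
  - destruct (R3 r) as [Hq1 Hq2]; [lra | ].
    apply (Hcross r (rho3 r)); lra. }
(* At s2 the first arc is at its end, below the third one by [HG]; at s3 the third arc is at its
   start, below the first one by [HF]. The zero in between is a crossing of the outer arcs, whose
   parameters are separated by s2 < s3. *)
destruct (IVT_zero (fun t => Z (rho3 t) - Z (rho1 t)) s2 s3) as [r [Hr Hz]].
- apply (continuity_minus (fun t => Z (rho3 t)) (fun t => Z (rho1 t))).
  + exact (continuity_comp rho3 Z C3 HZ).
  + exact (continuity_comp rho1 Z C1 HZ).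
- lra.
- rewrite E1. lra.
- rewrite E3. lra.
- destruct (R1 r Hr) as [Hq1 Hq2]. destruct (R3 r Hr) as [Hq3 Hq4].
  apply (Hcross (rho1 r) (rho3 r)); lra.
Qed.

(* The end of the loop is the largest [b] such that the curve is injective on
   [p, b). *)
Lemma simple_loop (X Z : R -> R) (p a0 b0 : R) :
  continuity X -> continuity Z ->
  (forall s, exists d, 0 < d /\ forall u v, Rabs (u - s) < d -> Rabs (v - s) < d ->
     X u = X v -> Z u = Z v -> u = v) ->
  p <= a0 -> a0 < b0 -> X a0 = X b0 -> Z a0 = Z b0 ->
  exists a b, p <= a /\ a < b /\ b <= b0 /\ X a = X b /\ Z a = Z b /\
    forall u v, a <= u < b -> a <= v < b -> X u = X v -> Z u = Z v -> u = v.
Proof.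
intros HX HZ Hloc Hp Hab HX0 HZ0.
set (inj := fun b => forall u v, p <= u -> u < v -> v <= b -> X u = X v -> Z u <> Z v).
set (E := fun b => p <= b /\ inj b).
assert (Hub : forall b, E b -> b < b0).
{ intros b [_ H]. apply Rnot_le_lt. intros Hb. apply (H a0 b0); lra. }
assert (Ep : E p) by (split; [lra | intros u v Hu Huv Hv; lra]).
destruct (completeness E) as [b [Hb1 Hb2]].
- exists b0. intros y Hy. left. now apply Hub.
- now exists p.
- assert (Hpb : p <= b) by now apply Hb1.
  assert (Hbb : b <= b0) by (apply Hb2; intros y Hy; left; now apply Hub).
  assert (Hinj : forall u v, p <= u -> u < v -> v < b -> X u = X v -> Z u <> Z v).
  { intros u v Hu Huv Hv. apply NNPP. intros Hn.
    assert (Hc : b <= v); [ | lra].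
    apply Hb2. intros y [Hy1 Hy2]. apply Rnot_lt_le. intros Hvy.
    apply Hn. apply Hy2; lra. }
  (* Otherwise the curve is injective on [p, b] and could be continued. On [p, b - d/2] its squared
     distance [D] to the point at b has a positive minimum m, so parameters slightly beyond b meet
     nothing there; on the remaining interval local injectivity at b applies. *)
  assert (Ha : exists a, p <= a < b /\ X a = X b /\ Z a = Z b).
  { apply NNPP. intros Hno.
    assert (Hinj' : inj b).
    { intros u v Hu Huv Hv HXuv HZuv. destruct (Req_dec v b) as [-> | Hvb].
      - apply Hno. exists u. repeat split; auto; lra.
      - apply (Hinj u v); auto; lra. }
    destruct (Hloc b) as [d [Hd Hdinj]].
    set (D := fun u => (X u - X b) * (X u - X b) + (Z u - Z b) * (Z u - Z b)).
    assert (CX : continuity (fun u => X u - X b))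
      by (apply (continuity_minus X (fun _ => X b)); [exact HX | now apply continuity_const]).
    assert (CZ : continuity (fun u => Z u - Z b))
      by (apply (continuity_minus Z (fun _ => Z b)); [exact HZ | now apply continuity_const]).
    assert (CD : continuity D).
    { apply (continuity_plus (fun u => (X u - X b) * (X u - X b))
        (fun u => (Z u - Z b) * (Z u - Z b))).
      - exact (continuity_mult _ _ CX CX).
      - exact (continuity_mult _ _ CZ CZ). }
    assert (Hm : exists m, 0 < m /\ forall u, p <= u <= b - d / 2 -> m <= D u).
    { destruct (Rle_dec p (b - d / 2)) as [Hpd | Hpd].
      - destruct (continuity_ab_min D p (b - d / 2) Hpd (fun c _ => CD c))
          as [mx [Hmin Hmx]].
        exists (D mx). split; [ | exact Hmin].
        assert (Hn : ~ (X mx = X b /\ Z mx = Z b)).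
        { intros [E1 E2]. apply Hno. exists mx. repeat split; auto; lra. }
        assert (H1 := Rle_0_sqr (X mx - X b)). assert (H2 := Rle_0_sqr (Z mx - Z b)).
        unfold Rsqr in H1, H2. unfold D.
        apply Rnot_le_lt. intros Hle. apply Hn.
        assert (E1 : (X mx - X b) * (X mx - X b) = 0) by lra.
        assert (E2 : (Z mx - Z b) * (Z mx - Z b) = 0) by lra.
        apply Rmult_integral in E1. apply Rmult_integral in E2. lra.
      - exists 1. split; [lra | ]. intros u Hu. lra. }
    destruct Hm as [m [Hm0 Hm]].
    destruct (continuity_pt_eps D b m (CD b) Hm0) as [h [Hh Hclose]].
    assert (Hk1 := Rmin_l d h). assert (Hk2 := Rmin_r d h).
    assert (Hk : 0 < Rmin d h) by now apply Rmin_pos.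
    assert (Hc : b + Rmin d h / 2 <= b); [ | lra].
    apply Hb1. split; [lra | ].
    intros u v Hu Huv Hv HXuv HZuv.
    destruct (Rle_dec v b) as [Hvb | Hvb]; [apply (Hinj' u v); auto | ].
    destruct (Rle_dec u (b - d / 2)) as [Hud | Hud].
    - assert (H1 := Hm u (conj Hu Hud)).
      assert (H2 : Rabs (D v - D b) < m) by (apply Hclose, Rabs_def1; lra).
      replace (D b) with 0 in H2 by (unfold D; ring).
      replace (D v) with (D u) in H2 by (unfold D; now rewrite HXuv, HZuv).
      apply Rabs_def2 in H2. lra.
    - assert (u = v); [ | lra].
      apply Hdinj; auto; apply Rabs_def1; lra. }
  destruct Ha as [a [Ha1 [Ha2 Ha3]]].
  exists a, b. repeat split; try lra.
  intros u v Hu Hv HXuv HZuv.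
  destruct (Rtotal_order u v) as [H | [H | H]]; [ | exact H | ]; exfalso.
  + apply (Hinj u v); auto; lra.
  + apply (Hinj v u); auto; lra.
Qed.

(** * A global Picard-Lindelöf theorem *)

(** Integrating the weight exp (mu |r|) reproduces it with a gain of 1/mu, which is the source of
    the contraction factor. The sign e in the proof treats both halves of the absolute value, and s
    < 0 is reduced to s > 0 by reflecting g. *)
Lemma exp_weight_bound (g dg : R -> R) (A mu T : R) :
  0 < mu -> 0 <= A -> g 0 = 0 ->
  (forall r, Rabs r <= T -> is_derive g r (dg r)) ->
  (forall r, Rabs r <= T -> Rabs (dg r) <= A * exp (mu * Rabs r)) ->
  forall s, Rabs s <= T -> Rabs (g s) <= A / mu * exp (mu * Rabs s).
Proof.
intros Hmu HA.
assert (Hpos : forall e h dh, h 0 = 0 -> (e = 1 \/ e = -1) ->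
  (forall r, Rabs r <= T -> is_derive h r (dh r)) ->
  (forall r, Rabs r <= T -> Rabs (dh r) <= A * exp (mu * Rabs r)) ->
  forall s, 0 <= s <= T -> e * h s <= A / mu * exp (mu * s)).
{ intros e h dh h0 He Hd Hb s Hs.
  assert (H : A / mu * exp (mu * 0) - e * h 0 <= A / mu * exp (mu * s) - e * h s).
  { apply (nondecreasing_of_derive (fun r => A / mu * exp (mu * r) - e * h r)
             (fun r => A * exp (mu * r) - e * dh r)); [lra | | ].
    - intros r Hr.
      assert (Hr' : Rabs r <= T) by (rewrite Rabs_pos_eq; lra).
      derive_with ltac:(apply Hd; assumption).
      field; lra.
    - intros r Hr.
      assert (Hr' : Rabs r <= T) by (rewrite Rabs_pos_eq; lra).
      specialize (Hb r Hr'). rewrite (Rabs_pos_eq r) in Hb by lra.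
      apply Rabs_le_between in Hb. destruct He; subst e; lra. }
  rewrite h0, Rmult_0_r, exp_0 in H.
  assert (0 <= A / mu) by (apply Rdiv_le_0_compat; lra). lra. }
intros g0 Hd Hb s Hs.
destruct (Rle_dec 0 s) as [Hs0 | Hs0].
- rewrite (Rabs_pos_eq s) in * by lra.
  assert (H1 := Hpos 1 g dg g0 (or_introl eq_refl) Hd Hb s (conj Hs0 Hs)).
  assert (H2 := Hpos (-1) g dg g0 (or_intror eq_refl) Hd Hb s (conj Hs0 Hs)).
  apply Rabs_le; lra.
- rewrite (Rabs_left s) in * by lra.
  assert (Hd' : forall r, Rabs r <= T -> is_derive (fun r => g (- r)) r (- dg (- r))).
  { intros r Hr. derive_with ltac:(apply Hd; rewrite Rabs_Ropp; assumption). ring. }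
  assert (Hb' : forall r, Rabs r <= T -> Rabs (- dg (- r)) <= A * exp (mu * Rabs r)).
  { intros r Hr. rewrite Rabs_Ropp, <- (Rabs_Ropp r). apply Hb.
    now rewrite Rabs_Ropp. }
  assert (Hs' : 0 <= - s <= T) by lra.
  assert (g0' : (fun r => g (- r)) 0 = 0) by (now rewrite Ropp_0).
  assert (H1 := Hpos 1 _ _ g0' (or_introl eq_refl) Hd' Hb' _ Hs').
  assert (H2 := Hpos (-1) _ _ g0' (or_intror eq_refl) Hd' Hb' _ Hs').
  cbv beta in H1, H2. rewrite Ropp_involutive in H1, H2. apply Rabs_le; lra.
Qed.

(** The range of w is restricted but that of q is not: q will enter only through its sine and
    cosine. The bound B accompanies the Lipschitz constant so that the class is closed under
    products. *)
Definition bounded_lipschitz (M : R) (F : R -> R -> R) : Prop :=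
  exists B L, 0 <= B /\ 0 <= L /\
    (forall w q, Rabs w <= M -> Rabs (F w q) <= B) /\
    (forall w q w' q', Rabs w <= M -> Rabs w' <= M ->
       Rabs (F w q - F w' q') <= L * (Rabs (w - w') + Rabs (q - q'))).

Lemma continuous_of_approx (f : R -> R) (x : R) :
  (forall e, 0 < e -> exists g : R -> R, continuous g x /\
     locally x (fun y => Rabs (f y - g y) <= e)) ->
  continuous f x.
Proof.
intros H. apply filterlim_locally. intros e.
assert (He : 0 < e / 4) by (destruct e as [e He]; simpl; lra).
destruct (H (e / 4) He) as [g [Hg Hl]].
assert (Hx := locally_singleton _ _ Hl). cbv beta in Hx.
apply filterlim_locally with (eps := mkposreal _ He) in Hg.
generalize (filter_and _ _ Hl Hg). apply filter_imp.
intros y [H1 H2].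
change (Rabs (f y - f x) < e).
change (Rabs (g y - g x) < e / 4) in H2.
replace (f y - f x) with ((f y - g y) + ((g y - g x) - (f x - g x))) by ring.
eapply Rle_lt_trans; [apply Rabs_triang | ].
assert (Rabs (g y - g x - (f x - g x)) <= e / 4 + e / 4).
{ eapply Rle_trans; [apply Rabs_triang | ]. rewrite Rabs_Ropp. lra. }
destruct e as [e He']; simpl in *; lra.
Qed.

Lemma geometric_limit (u : nat -> R) (A : R) :
  (forall n, Rabs (u (S n) - u n) <= A * (/ 2) ^ n) ->
  is_lim_seq u (real (Lim_seq u)) /\
  forall n, Rabs (real (Lim_seq u) - u n) <= 2 * A * (/ 2) ^ n.
Proof.
intros Hu.
(* The factor 1 - (1/2)^k, from the partial sum of the geometric series, is what lets the induction
   on k close; it is dropped in [Hgap']. *)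
assert (Hgap : forall n k, Rabs (u (n + k)%nat - u n) <= 2 * A * (/ 2) ^ n * (1 - (/ 2) ^ k)).
{ intros n k. induction k as [ | k IH].
  - rewrite Nat.add_0_r, Rminus_diag, Rabs_R0. simpl. lra.
  - replace (n + S k)%nat with (S (n + k)) by lia.
    replace (u (S (n + k)) - u n) with ((u (S (n + k)) - u (n + k)%nat) + (u (n + k)%nat - u n)) by ring.
    eapply Rle_trans; [apply Rabs_triang | ].
    specialize (Hu (n + k)%nat). rewrite pow_add in Hu. simpl. lra. }
assert (HA : 0 <= A).
{ specialize (Hu 0%nat). simpl in Hu.
  assert (H := Rabs_pos (u 1%nat - u 0%nat)). lra. }
assert (Hp : forall n, 0 < (/ 2) ^ n) by (intros; apply pow_lt; lra).
assert (Hgap' : forall n k, Rabs (u (n + k)%nat - u n) <= 2 * A * (/ 2) ^ n).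
{ intros n k. eapply Rle_trans; [apply Hgap | ].
  specialize (Hp k) as Hk. specialize (Hp n) as Hn.
  rewrite <- (Rmult_1_r (2 * A * (/ 2) ^ n)) at 2.
  apply Rmult_le_compat_l; [ | lra].
  apply Rmult_le_pos; lra. }
assert (Hc : ex_finite_lim_seq u).
{ apply ex_lim_seq_cauchy_corr. intros eps.
  assert (Hg : is_lim_seq (fun n => (4 * A) * (/ 2) ^ n) 0).
  { replace (Finite 0) with (Rbar_mult (4 * A) 0) by (simpl; f_equal; ring).
    apply is_lim_seq_scal_l. apply is_lim_seq_geom. rewrite Rabs_pos_eq; lra. }
  apply is_lim_seq_spec in Hg. destruct (Hg eps) as [N HN].
  exists N. intros n m Hn Hm.
  specialize (HN N (Nat.le_refl N)). rewrite Rminus_0_r in HN.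
  apply Rabs_def2 in HN.
  replace (u n - u m) with ((u n - u N) - (u m - u N)) by ring.
  eapply Rle_lt_trans; [apply Rabs_triang | ]. rewrite Rabs_Ropp.
  assert (H1 := Hgap' N (n - N)%nat). assert (H2 := Hgap' N (m - N)%nat).
  replace (N + (n - N))%nat with n in H1 by lia.
  replace (N + (m - N))%nat with m in H2 by lia. lra. }
apply Lim_seq_correct' in Hc.
split; [exact Hc | ].
intros n. apply Rabs_le.
assert (Hs : is_lim_seq (fun k => u (n + k)%nat) (real (Lim_seq u))).
{ apply is_lim_seq_ext with (fun k => u (k + n)%nat).
  - intros k; f_equal; lia.
  - now apply is_lim_seq_incr_n with (N := n) (u := u). }
assert (H1 : Rbar_le (real (Lim_seq u)) (u n + 2 * A * (/ 2) ^ n)).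
{ refine (is_lim_seq_le _ _ _ _ _ Hs (is_lim_seq_const _)).
  intros k. specialize (Hgap' n k). apply Rabs_le_between in Hgap'. lra. }
assert (H2 : Rbar_le (u n - 2 * A * (/ 2) ^ n) (real (Lim_seq u))).
{ refine (is_lim_seq_le _ _ _ _ _ (is_lim_seq_const _) Hs).
  intros k. specialize (Hgap' n k). apply Rabs_le_between in Hgap'. lra. }
simpl in H1, H2. lra.
Qed.

Lemma mean_value_bound (g dg : R -> R) (C T : R) :
  g 0 = 0 ->
  (forall r, Rabs r <= T -> is_derive g r (dg r)) ->
  (forall r, Rabs r <= T -> Rabs (dg r) <= C) ->
  forall s, Rabs s <= T -> Rabs (g s) <= C * Rabs s.
Proof.
intros g0 Hd Hb s Hs.
assert (Hin : forall r, Rmin 0 s <= r <= Rmax 0 s -> Rabs r <= T).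
{ intros r Hr. apply Rabs_le_between in Hs.
  unfold Rmin, Rmax in Hr. destruct (Rle_dec 0 s); apply Rabs_le; lra. }
destruct (MVT_gen g 0 s dg) as [c [Hc Hv]].
- intros r Hr. apply Hd, Hin. lra.
- intros r Hr. eapply is_derive_continuity, Hd, Hin, Hr.
- rewrite g0, !Rminus_0_r in Hv. rewrite Hv, Rabs_mult.
  apply Rmult_le_compat_r; [apply Rabs_pos | ]. apply Hb, Hin, Hc.
Qed.

Lemma geometric_squeeze (x C : R) :
  (forall n : nat, Rabs x <= C * (/ 2) ^ n) -> x = 0.
Proof.
intros H.
assert (Hg : is_lim_seq (fun n => C * (/ 2) ^ n) 0).
{ replace (Finite 0) with (Rbar_mult C 0) by (simpl; f_equal; ring).
  apply is_lim_seq_scal_l, is_lim_seq_geom. rewrite Rabs_pos_eq; lra. }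
assert (Hle := is_lim_seq_le _ _ (Finite (Rabs x)) (Finite 0) H
                 (is_lim_seq_const _) Hg).
simpl in Hle. assert (Hp := Rabs_pos x).
destruct (Req_dec x 0) as [ | Hx]; [assumption | ].
apply Rabs_pos_lt in Hx. lra.
Qed.

Lemma continuous_bounded_lipschitz (F : R -> R -> R) (a b : R -> R) (x : R) :
  (forall M, bounded_lipschitz M F) -> continuous a x -> continuous b x ->
  continuous (fun r => F (a r) (b r)) x.
Proof.
intros HF Ha Hb.
destruct (HF (Rabs (a x) + 1)) as [B [L [_ [HL [_ Hlip]]]]].
apply filterlim_locally. intros e.
(* The 1 keeps a r in the range |w| <= |a x| + 1 on which L is valid, and L + 1 avoids a division by
   zero when L = 0. *)
assert (He : 0 < Rmin 1 (e / (2 * (L + 1)))).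
{ apply Rmin_glb_lt; [lra | ].
  apply Rdiv_lt_0_compat; [apply cond_pos | lra]. }
apply filterlim_locally with (eps := mkposreal _ He) in Ha.
apply filterlim_locally with (eps := mkposreal _ He) in Hb.
generalize (filter_and _ _ Ha Hb). apply filter_imp.
intros r [H1 H2].
change (Rabs (a r - a x) < Rmin 1 (e / (2 * (L + 1)))) in H1.
change (Rabs (b r - b x) < Rmin 1 (e / (2 * (L + 1)))) in H2.
change (Rabs (F (a r) (b r) - F (a x) (b x)) < e).
assert (H3 := Rmin_l 1 (e / (2 * (L + 1)))).
assert (H4 := Rmin_r 1 (e / (2 * (L + 1)))).
eapply Rle_lt_trans.
- apply Hlip; [ | lra].
  replace (a r) with (a x + (a r - a x)) by ring.
  eapply Rle_trans; [apply Rabs_triang | lra].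
- apply Rle_lt_trans with (L * (2 * (e / (2 * (L + 1))))).
  + apply Rmult_le_compat_l; lra.
  + assert (Hpos := cond_pos e).
    replace (L * (2 * (e / (2 * (L + 1))))) with (e * (L / (L + 1))) by (field; lra).
    assert (L / (L + 1) < 1) by (apply Rlt_div_l; lra).
    rewrite <- (Rmult_1_r e) at 2. apply Rmult_lt_compat_l; lra.
Qed.

Section Picard.

Variables (F : bool -> R -> R -> R) (K : R).
Hypothesis F_bound : forall w q, Rabs (F true w q) <= K.
Hypothesis F_lip : forall M i, bounded_lipschitz M (F i).

(** The boolean selects the component of a planar system: [true] is w, whose velocity is bounded by
    [K], and [false] is q. Zero initial values suffice: q = 0 is a horizontal start, and the value
    of w is absorbed by x = (c - w) / (2 tau). *)
Fixpoint picard_iter (n : nat) (i : bool) (s : R) : R :=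
  match n with
  | O => 0
  | S n => RInt (fun r => F i (picard_iter n true r) (picard_iter n false r)) 0 s
  end.

Definition picard_lim (i : bool) (s : R) : R :=
  real (Lim_seq (fun n => picard_iter n i s)).

Lemma is_derive_RInt_from_0 (f : R -> R) (s : R) :
  (forall r, continuous f r) -> is_derive (RInt f 0) s (f s).
Proof.
intros Hf. apply (is_derive_RInt f (RInt f 0) 0 s); [ | apply Hf].
apply filter_forall. intros b. apply (RInt_correct (V := R_CompleteNormedModule)).
apply (ex_RInt_continuous (V := R_CompleteNormedModule)). intros; apply Hf.
Qed.

Lemma RInt_0_0 (f : R -> R) : RInt f 0 0 = 0.
Proof. apply (RInt_point (V := R_CompleteNormedModule)). Qed.

Lemma picard_iter_0 n i : picard_iter n i 0 = 0.
Proof. destruct n; [reflexivity | apply RInt_0_0]. Qed.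

Lemma picard_iter_derive n i s :
  is_derive (picard_iter (S n) i) s (F i (picard_iter n true s) (picard_iter n false s)).
Proof.
revert i s. induction n as [ | n IH]; intros i s.
- apply is_derive_RInt_from_0 with (f := fun r => F i 0 0). intros r. apply continuous_const.
- apply (is_derive_RInt_from_0
    (fun r => F i (picard_iter (S n) true r) (picard_iter (S n) false r))).
  intros r. apply continuous_bounded_lipschitz; [auto | | ];
    eapply (ex_derive_continuous (V := R_NormedModule)); eexists; apply IH.
Qed.

Lemma picard_iter_continuous n i s : continuous (picard_iter n i) s.
Proof.
destruct n.
- apply continuous_const.
- apply (ex_derive_continuous (V := R_NormedModule)). eexists. apply picard_iter_derive.
Qed.

Lemma picard_iter_bound n s : Rabs (picard_iter n true s) <= K * Rabs s.
Proof.
assert (HK : 0 <= K) by (eapply Rle_trans; [apply Rabs_pos | apply (F_bound 0 0)]).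
destruct n.
- simpl. rewrite Rabs_R0. apply Rmult_le_pos; [lra | apply Rabs_pos].
- apply (mean_value_bound (picard_iter (S n) true)
    (fun s => F true (picard_iter n true s) (picard_iter n false s)) K (Rabs s)).
  + apply picard_iter_0.
  + intros; apply picard_iter_derive.
  + intros; apply F_bound.
  + lra.
Qed.

(* Bielecki's weight [exp (mu |s|)] with [mu = 4 L] makes the iteration a
   contraction with factor [1/2] on the whole interval. *)
Lemma picard_iter_gap T : 0 <= T -> exists A L : R, 0 <= L /\
  (forall i w q w' q', Rabs w <= K * T -> Rabs w' <= K * T ->
     Rabs (F i w q - F i w' q') <= L * (Rabs (w - w') + Rabs (q - q'))) /\
  forall n i s, Rabs s <= T ->
    Rabs (picard_iter (S n) i s - picard_iter n i s) <= A * (/ 2) ^ n.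
Proof.
intros HT.
assert (HK : 0 <= K) by (eapply Rle_trans; [apply Rabs_pos | apply (F_bound 0 0)]).
destruct (F_lip (K * T) true) as [B1 [L1 [HB1 [HL1 [Hb1 Hl1]]]]].
destruct (F_lip (K * T) false) as [B2 [L2 [HB2 [HL2 [Hb2 Hl2]]]]].
(* The added 1 makes L, hence mu, positive even if both Lipschitz constants are 0. *)
set (B := B1 + B2). set (L := L1 + L2 + 1). set (mu := 4 * L).
assert (Hb : forall i w q, Rabs w <= K * T -> Rabs (F i w q) <= B).
{ intros [ | ] w q Hw; [specialize (Hb1 w q Hw) | specialize (Hb2 w q Hw)];
    unfold B; lra. }
assert (Hl : forall i w q w' q', Rabs w <= K * T -> Rabs w' <= K * T ->
     Rabs (F i w q - F i w' q') <= L * (Rabs (w - w') + Rabs (q - q'))).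
{ intros [ | ] w q w' q' Hw Hw';
    [eapply Rle_trans; [apply Hl1 | ] | eapply Rle_trans; [apply Hl2 | ]]; auto;
    apply Rmult_le_compat_r; try (unfold L; lra);
    apply Rplus_le_le_0_compat; apply Rabs_pos. }
assert (HL : 1 <= L) by (unfold L; lra).
assert (Hmu : 0 < mu) by (unfold mu; lra).
assert (HB : 0 <= B) by (unfold B; lra).
assert (Hw : forall n s, Rabs s <= T -> Rabs (picard_iter n true s) <= K * T).
{ intros n s Hs. eapply Rle_trans; [apply picard_iter_bound | ].
  apply Rmult_le_compat_l; lra. }
assert (Hgap : forall n i s, Rabs s <= T ->
  Rabs (picard_iter (S n) i s - picard_iter n i s)
    <= B / mu * (/ 2) ^ n * exp (mu * Rabs s)).
{ induction n as [ | n IH]; intros i s Hs.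
  - rewrite Rminus_0_r, pow_O, Rmult_1_r.
    apply (exp_weight_bound (picard_iter 1 i) (fun s => F i 0 0) B mu T);
      try assumption.
    + apply picard_iter_0.
    + intros r _. apply (picard_iter_derive 0 i r).
    + intros r Hr. apply Rle_trans with B.
      * apply Hb. rewrite Rabs_R0. apply Rmult_le_pos; lra.
      * rewrite <- (Rmult_1_r B) at 1. apply Rmult_le_compat_l; [lra | ].
        rewrite <- exp_0. destruct (Rle_lt_or_eq_dec 0 (mu * Rabs r)) as [H | H].
        -- apply Rmult_le_pos; [lra | apply Rabs_pos].
        -- left. now apply exp_increasing.
        -- rewrite <- H. lra.
  (* The gaps of the two components add up to a factor 2 L in the derivative; integration against
     the weight divides it by mu = 4 L, which leaves 1/2. *)
  - replace (B / mu * (/ 2) ^ S n) with ((2 * L * (B / mu * (/ 2) ^ n)) / mu)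
      by (simpl; unfold mu; field; lra).
    apply (exp_weight_bound
      (fun s => picard_iter (S (S n)) i s - picard_iter (S n) i s)
      (fun s => F i (picard_iter (S n) true s) (picard_iter (S n) false s)
              - F i (picard_iter n true s) (picard_iter n false s)) _ mu T);
      try assumption.
    + apply Rmult_le_pos; [lra | ]. apply Rmult_le_pos; [ | apply pow_le; lra].
      apply Rdiv_le_0_compat; lra.
    + rewrite !picard_iter_0. ring.
    + intros r _. apply (is_derive_minus (V := R_NormedModule)
        (picard_iter (S (S n)) i) (picard_iter (S n) i)); apply picard_iter_derive.
    + intros r Hr. eapply Rle_trans; [apply Hl; apply Hw; exact Hr | ].
      assert (H1 := IH true r Hr). assert (H2 := IH false r Hr).
      rewrite !Rmult_assoc in *. rewrite (Rmult_comm 2 (L * _)), (Rmult_assoc L).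
      apply Rmult_le_compat_l; lra. }
exists (B / mu * exp (mu * T)), L. repeat split; [lra | exact Hl | ].
intros n i s Hs. eapply Rle_trans; [apply Hgap, Hs | ].
rewrite Rmult_assoc, (Rmult_comm _ (exp _)), <- Rmult_assoc.
apply Rmult_le_compat_r; [apply pow_le; lra | ].
apply Rmult_le_compat_l; [apply Rdiv_le_0_compat; lra | ].
destruct (Rle_lt_or_eq_dec _ _ Hs) as [H | H].
- left. apply exp_increasing, Rmult_lt_compat_l; lra.
- rewrite H; lra.
Qed.

Lemma picard_lim_spec T : 0 <= T -> exists A L : R, 0 <= L /\
  (forall i w q w' q', Rabs w <= K * T -> Rabs w' <= K * T ->
     Rabs (F i w q - F i w' q') <= L * (Rabs (w - w') + Rabs (q - q'))) /\
  forall n i s, Rabs s <= T ->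
    Rabs (picard_lim i s - picard_iter n i s) <= A * (/ 2) ^ n.
Proof.
intros HT. destruct (picard_iter_gap T HT) as [A [L [HL [Hl Hgap]]]].
exists (2 * A), L. repeat split; auto.
intros n i s Hs.
apply (geometric_limit (fun n => picard_iter n i s)).
intros m. now apply Hgap.
Qed.

Lemma picard_lim_bound s : Rabs (picard_lim true s) <= K * Rabs s.
Proof.
destruct (picard_iter_gap (Rabs s) (Rabs_pos s)) as [A [L [_ [_ Hgap]]]].
assert (Hl := proj1 (geometric_limit (fun n => picard_iter n true s) A
                (fun n => Hgap n true s (Rle_refl _)))).
apply is_lim_seq_abs in Hl.
refine (is_lim_seq_le _ _ (Finite _) (Finite _) _ Hl (is_lim_seq_const _)).
intros n. apply picard_iter_bound.
Qed.

Lemma picard_lim_continuous i s : continuous (picard_lim i) s.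
Proof.
assert (HT : 0 <= Rabs s + 1) by (assert (H := Rabs_pos s); lra).
destruct (picard_lim_spec _ HT) as [A [_ [_ [_ Hb]]]].
apply continuous_of_approx. intros e He.
assert (Hg : is_lim_seq (fun n => A * (/ 2) ^ n) 0).
{ replace (Finite 0) with (Rbar_mult A 0) by (simpl; f_equal; ring).
  apply is_lim_seq_scal_l, is_lim_seq_geom. rewrite Rabs_pos_eq; lra. }
apply is_lim_seq_spec in Hg. destruct (Hg (mkposreal e He)) as [N HN].
specialize (HN N (Nat.le_refl N)). simpl in HN. rewrite Rminus_0_r in HN.
apply Rabs_def2 in HN.
exists (picard_iter N i). split; [apply picard_iter_continuous | ].
exists (mkposreal 1 Rlt_0_1). intros y Hy.
change (Rabs (y - s) < 1) in Hy.
eapply Rle_trans; [apply Hb | lra].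
replace y with (s + (y - s)) by ring.
eapply Rle_trans; [apply Rabs_triang | lra].
Qed.

Lemma picard_lim_integral i s :
  picard_lim i s = RInt (fun r => F i (picard_lim true r) (picard_lim false r)) 0 s.
Proof.
destruct (picard_lim_spec _ (Rabs_pos s)) as [A [L [HL [Hl Hb]]]].
assert (HK : 0 <= K) by (eapply Rle_trans; [apply Rabs_pos | apply (F_bound 0 0)]).
set (f := fun r => F i (picard_lim true r) (picard_lim false r)).
apply Rminus_diag_uniq.
(* Both sides are compared with iterate n + 1: the limit is within A / 2^n of it, and the two
   integrands differ by at most L times the gaps of both components at step n, over a length |s|. *)
apply geometric_squeeze with (A + L * (A + A) * Rabs s). intros n.
replace (picard_lim i s - RInt f 0 s) with
  ((picard_lim i s - picard_iter (S n) i s) - (RInt f 0 s - picard_iter (S n) i s)) by ring.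
eapply Rle_trans; [apply Rabs_triang | ]. rewrite Rabs_Ropp, Rmult_plus_distr_r.
assert (Hh : 0 < (/ 2) ^ n) by (apply pow_lt; lra).
apply Rplus_le_compat.
- eapply Rle_trans; [apply Hb; lra | ].
  assert (HA : 0 <= A * (/ 2) ^ n)
    by (eapply Rle_trans; [apply Rabs_pos | apply (Hb n i s); lra]).
  simpl. lra.
- apply Rle_trans with (L * (A + A) * (/ 2) ^ n * Rabs s); [ | lra].
  apply (mean_value_bound (fun s => RInt f 0 s - picard_iter (S n) i s)
    (fun r => f r - F i (picard_iter n true r) (picard_iter n false r)) _ (Rabs s)).
  + rewrite RInt_0_0, picard_iter_0. ring.
  + intros r _. apply (is_derive_minus (V := R_NormedModule) (RInt f 0)
      (picard_iter (S n) i)); [ | apply picard_iter_derive].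
    apply is_derive_RInt_from_0. intros x.
    apply continuous_bounded_lipschitz; auto using picard_lim_continuous.
  + intros r Hr. eapply Rle_trans.
    * apply Hl.
      -- eapply Rle_trans; [apply picard_lim_bound | apply Rmult_le_compat_l; lra].
      -- eapply Rle_trans; [apply picard_iter_bound | apply Rmult_le_compat_l; lra].
    * rewrite Rmult_assoc. apply Rmult_le_compat_l; [lra | ].
      assert (H1 := Hb n true r Hr). assert (H2 := Hb n false r Hr). lra.
  + lra.
Qed.

Theorem picard_lindelof : exists u : bool -> R -> R,
  (forall i, u i 0 = 0) /\
  forall i s, is_derive (u i) s (F i (u true s) (u false s)).
Proof.
exists picard_lim. split.
- intros i. rewrite picard_lim_integral. apply RInt_0_0.
- intros i s.
  apply (is_derive_ext
    (RInt (fun r => F i (picard_lim true r) (picard_lim false r)) 0)).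
  + intros t. symmetry. apply picard_lim_integral.
  + apply (is_derive_RInt_from_0 (fun r => F i (picard_lim true r) (picard_lim false r))).
    intros x. apply continuous_bounded_lipschitz; auto using picard_lim_continuous.
Qed.

End Picard.

(** * Right-hand sides admissible for the Picard iteration *)

Lemma bounded_lipschitz_const M k : bounded_lipschitz M (fun _ _ => k).
Proof.
exists (Rabs k), 0. repeat split; try apply Rabs_pos; try lra.
- intros; lra.
- intros. rewrite Rminus_diag, Rabs_R0. lra.
Qed.

Lemma bounded_lipschitz_fst M : bounded_lipschitz M (fun w _ => w).
Proof.
exists (Rabs M), 1. repeat split; try apply Rabs_pos; try lra.
- intros w _ Hw. eapply Rle_trans; [exact Hw | apply Rle_abs].
- intros w q w' q' _ _. assert (H := Rabs_pos (q - q')). lra.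
Qed.

Lemma sin_cos_lipschitz a b :
  Rabs (sin a - sin b) <= Rabs (a - b) /\ Rabs (cos a - cos b) <= Rabs (a - b).
Proof.
split.
- destruct (MVT_gen sin b a cos) as [c [_ Hc]].
  + intros x _. apply is_derive_Reals, derivable_pt_lim_sin.
  + intros x _. apply continuity_sin.
  + rewrite Hc, Rabs_mult.
    assert (Rabs (cos c) <= 1) by (apply Rabs_le, COS_bound).
    assert (Hp := Rabs_pos (a - b)). nra.
- destruct (MVT_gen cos b a (fun x => - sin x)) as [c [_ Hc]].
  + intros x _. apply is_derive_Reals, derivable_pt_lim_cos.
  + intros x _. apply continuity_cos.
  + rewrite Hc, Rabs_mult, Rabs_Ropp.
    assert (Rabs (sin c) <= 1) by (apply Rabs_le, SIN_bound).
    assert (Hp := Rabs_pos (a - b)). nra.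
Qed.

Lemma bounded_lipschitz_sin M : bounded_lipschitz M (fun _ q => sin q).
Proof.
exists 1, 1. repeat split; try lra.
- intros. apply Rabs_le, SIN_bound.
- intros w q w' q' _ _. assert (H := proj1 (sin_cos_lipschitz q q')).
  assert (H' := Rabs_pos (w - w')). lra.
Qed.

Lemma bounded_lipschitz_cos M : bounded_lipschitz M (fun _ q => cos q).
Proof.
exists 1, 1. repeat split; try lra.
- intros. apply Rabs_le, COS_bound.
- intros w q w' q' _ _. assert (H := proj2 (sin_cos_lipschitz q q')).
  assert (H' := Rabs_pos (w - w')). lra.
Qed.

Lemma bounded_lipschitz_plus M F G :
  bounded_lipschitz M F -> bounded_lipschitz M G ->
  bounded_lipschitz M (fun w q => F w q + G w q).
Proof.
intros [B1 [L1 [HB1 [HL1 [Hb1 Hl1]]]]] [B2 [L2 [HB2 [HL2 [Hb2 Hl2]]]]].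
exists (B1 + B2), (L1 + L2). repeat split; try lra.
- intros w q Hw. eapply Rle_trans; [apply Rabs_triang | ].
  specialize (Hb1 w q Hw). specialize (Hb2 w q Hw). lra.
- intros w q w' q' Hw Hw'.
  replace (F w q + G w q - (F w' q' + G w' q')) with
    ((F w q - F w' q') + (G w q - G w' q')) by ring.
  eapply Rle_trans; [apply Rabs_triang | ].
  specialize (Hl1 w q w' q' Hw Hw'). specialize (Hl2 w q w' q' Hw Hw'). lra.
Qed.

Lemma bounded_lipschitz_mult M F G :
  bounded_lipschitz M F -> bounded_lipschitz M G ->
  bounded_lipschitz M (fun w q => F w q * G w q).
Proof.
intros [B1 [L1 [HB1 [HL1 [Hb1 Hl1]]]]] [B2 [L2 [HB2 [HL2 [Hb2 Hl2]]]]].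
exists (B1 * B2), (B1 * L2 + B2 * L1). repeat split.
- now apply Rmult_le_pos.
- apply Rplus_le_le_0_compat; now apply Rmult_le_pos.
- intros w q Hw. rewrite Rabs_mult.
  apply Rmult_le_compat; auto using Rabs_pos.
- intros w q w' q' Hw Hw'.
  replace (F w q * G w q - F w' q' * G w' q') with
    (F w q * (G w q - G w' q') + G w' q' * (F w q - F w' q')) by ring.
  eapply Rle_trans; [apply Rabs_triang | ]. rewrite !Rabs_mult, Rmult_plus_distr_r, !Rmult_assoc.
  apply Rplus_le_compat; apply Rmult_le_compat; auto using Rabs_pos.
Qed.

(** 1/F - 1/F' = -(F - F') / (F F') with F F' >= 1, so the Lipschitz constant is preserved. *)
Lemma bounded_lipschitz_inv M F :
  (forall w q, 1 <= F w q) -> bounded_lipschitz M F ->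
  bounded_lipschitz M (fun w q => / F w q).
Proof.
intros H1 [B [L [HB [HL [Hb Hl]]]]].
assert (Hi : forall w q, 0 < / F w q <= 1).
{ intros w q. specialize (H1 w q). split.
  - apply Rinv_0_lt_compat; lra.
  - rewrite <- Rinv_1. apply Rinv_le_contravar; lra. }
exists 1, L. repeat split; try lra.
- intros w q _. specialize (Hi w q). rewrite Rabs_pos_eq; lra.
- intros w q w' q' Hw Hw'. eapply Rle_trans; [ | apply (Hl w q w' q' Hw Hw')].
  assert (H2 := H1 w q). assert (H3 := H1 w' q').
  replace (/ F w q - / F w' q') with ((/ F w q * / F w' q') * (- (F w q - F w' q')))
    by (field; lra).
  rewrite Rabs_mult, Rabs_Ropp.
  assert (H4 := Hi w q). assert (H5 := Hi w' q').
  rewrite Rabs_pos_eq by nra.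
  rewrite <- (Rmult_1_l (Rabs _)) at 2.
  apply Rmult_le_compat_r; [apply Rabs_pos | nra].
Qed.

(** The difference of the square roots is that of the values divided by the sum of the roots, which
    is at least 1; the constants are preserved. *)
Lemma bounded_lipschitz_sqrt M F :
  (forall w q, 1 <= F w q) -> bounded_lipschitz M F ->
  bounded_lipschitz M (fun w q => sqrt (F w q)).
Proof.
intros H1 [B [L [HB [HL [Hb Hl]]]]].
assert (Hs : forall w q, 1 <= sqrt (F w q)).
{ intros w q. rewrite <- sqrt_1. apply sqrt_le_1_alt, H1. }
assert (Hq : forall w q, sqrt (F w q) * sqrt (F w q) = F w q).
{ intros w q. apply sqrt_sqrt. specialize (H1 w q). lra. }
exists B, L. repeat split; try lra.
- intros w q Hw. eapply Rle_trans; [ | apply (Hb w q Hw)].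
  specialize (Hs w q). specialize (Hq w q).
  rewrite !Rabs_pos_eq by nra. nra.
- intros w q w' q' Hw Hw'. eapply Rle_trans; [ | apply (Hl w q w' q' Hw Hw')].
  replace (F w q - F w' q') with
    ((sqrt (F w q) + sqrt (F w' q')) * (sqrt (F w q) - sqrt (F w' q')))
    by (rewrite <- (Hq w q) at 3; rewrite <- (Hq w' q') at 3; ring).
  rewrite Rabs_mult.
  assert (H2 := Hs w q). assert (H3 := Hs w' q').
  rewrite (Rabs_pos_eq (_ + _)) by lra.
  rewrite <- (Rmult_1_l (Rabs _)) at 1.
  apply Rmult_le_compat_r; [apply Rabs_pos | lra].
Qed.

(** * Smoothness *)

(** Class C^n, with the derivative given as a witness: closure under an operation is then an
    induction in which the derivative is written explicitly, within the same class of
    expressions. *)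
Fixpoint smooth (n : nat) (f : R -> R) : Prop :=
  match n with
  | O => forall x, continuous f x
  | S n => exists df, (forall x, is_derive f x (df x)) /\ smooth n df
  end.

Lemma smooth_pred n f : smooth (S n) f -> smooth n f.
Proof.
revert f. induction n as [ | n IH]; intros f [df [Hd Hs]].
- intros x. apply (ex_derive_continuous (V := R_NormedModule)). now exists (df x).
- exists df. auto.
Qed.

Lemma smooth_const n k : smooth n (fun _ => k).
Proof.
revert k. induction n as [ | n IH]; intros k.
- intros x. apply continuous_const.
- exists (fun _ => 0). split; [ | apply IH].
  intros x. apply (is_derive_const (V := R_NormedModule)).
Qed.

Lemma smooth_plus n f g : smooth n f -> smooth n g -> smooth n (fun x => f x + g x).
Proof.
revert f g. induction n as [ | n IH]; intros f g.
- intros Hf Hg x. apply (continuous_plus (V := R_NormedModule)); auto.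
- intros [df [Hf Sf]] [dg [Hg Sg]]. exists (fun x => df x + dg x).
  split; [ | now apply IH].
  intros x. apply (is_derive_plus (V := R_NormedModule)); auto.
Qed.

Lemma smooth_mult n f g : smooth n f -> smooth n g -> smooth n (fun x => f x * g x).
Proof.
revert f g. induction n as [ | n IH]; intros f g.
- intros Hf Hg x. apply (continuous_mult (K := R_AbsRing)); auto.
- intros Hf Hg. assert (Hf' := smooth_pred _ _ Hf). assert (Hg' := smooth_pred _ _ Hg).
  destruct Hf as [df [Hf Sf]]. destruct Hg as [dg [Hg Sg]].
  exists (fun x => df x * g x + f x * dg x). split.
  + intros x. apply (is_derive_mult (K := R_AbsRing)); auto. intros; apply Rmult_comm.
  + apply smooth_plus; apply IH; auto.
Qed.

Lemma smooth_sin_cos n f :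
  smooth n f -> smooth n (fun x => sin (f x)) /\ smooth n (fun x => cos (f x)).
Proof.
revert f. induction n as [ | n IH]; intros f.
- intros Hf. split; intros x; apply continuous_comp; auto;
    apply continuity_pt_filterlim; [apply continuity_sin | apply continuity_cos].
- intros Hf. destruct (IH f (smooth_pred _ _ Hf)) as [Hs Hc].
  destruct Hf as [df [Hf Sf]]. split.
  + exists (fun x => df x * cos (f x)). split; [ | now apply smooth_mult].
    intros x. derive_with ltac:(apply Hf). ring.
  + exists (fun x => df x * (- 1 * sin (f x))). split.
    * intros x. derive_with ltac:(apply Hf). ring.
    * apply smooth_mult; [assumption | apply smooth_mult]; auto using smooth_const.
Qed.

Lemma smooth_inv n f : (forall x, f x <> 0) -> smooth n f -> smooth n (fun x => / f x).
Proof.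
intros H0. revert f H0. induction n as [ | n IH]; intros f H0 Hf.
- intros x. apply continuous_comp; auto.
  apply continuous_Rinv, H0.
- assert (Hf' := smooth_pred _ _ Hf). destruct Hf as [df [Hf Sf]].
  exists (fun x => -1 * (df x * (/ f x * / f x))). split.
  + intros x. derive_with ltac:(apply Hf); [apply H0 | ].
    field. apply H0.
  + apply smooth_mult; [apply smooth_const | ].
    apply smooth_mult; [assumption | ]. apply smooth_mult; now apply IH.
Qed.

Lemma smooth_sqrt n f : (forall x, 0 < f x) -> smooth n f -> smooth n (fun x => sqrt (f x)).
Proof.
intros H0. revert f H0. induction n as [ | n IH]; intros f H0 Hf.
- intros x. apply continuous_comp; auto. apply continuous_sqrt.
- assert (Hf' := smooth_pred _ _ Hf). destruct Hf as [df [Hf Sf]].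
  exists (fun x => / 2 * (df x * / sqrt (f x))). split.
  + intros x. assert (0 < sqrt (f x)) by (apply sqrt_lt_R0, H0).
    derive_with ltac:(apply Hf); [apply H0 | ]. field. lra.
  + apply smooth_mult; [apply smooth_const | ]. apply smooth_mult; [assumption | ].
    apply smooth_inv; [ | now apply IH].
    intros x. apply Rgt_not_eq, sqrt_lt_R0, H0.
Qed.

Lemma continuity_2d_pt_fst f x y : continuous f x -> continuity_2d_pt (fun u _ => f u) x y.
Proof.
intros Hf. apply (continuity_1d_2d_pt_comp f (fun u _ => u)).
- now apply continuity_pt_filterlim.
- apply continuity_2d_pt_id1.
Qed.

(** The coordinates of the surfaces constructed below, and of their normals, are affine in t. This
    shape is stable under both partial derivatives: the one in v is g + v * 0. *)
Lemma ex_diff_n_affine n f g :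
  smooth n f -> smooth n g -> forall x y, ex_diff_n (fun u v => f u + v * g u) n x y.
Proof.
revert f g.
assert (Hc : forall f g, smooth 0 f -> smooth 0 g ->
  forall x y, continuity_2d_pt (fun u v => f u + v * g u) x y).
{ intros f g Hf Hg x y. apply continuity_2d_pt_plus.
  - now apply continuity_2d_pt_fst.
  - apply continuity_2d_pt_mult; [apply continuity_2d_pt_id2 | ].
    now apply continuity_2d_pt_fst. }
assert (H0 : forall k f, smooth k f -> smooth 0 f).
{ intros k. induction k as [ | k IH]; intros f Hf; [exact Hf | apply IH, smooth_pred, Hf]. }
induction n as [ | n IH]; intros f g Hf Hg x y.
{ split; auto. }
assert (Hf' := smooth_pred _ _ Hf). assert (Hg' := smooth_pred _ _ Hg).
assert (Hf0 := H0 _ _ Hf). assert (Hg0 := H0 _ _ Hg).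
destruct Hf as [df [Hf Sf]]. destruct Hg as [dg [Hg Sg]].
assert (D1 : forall u v, is_derive (fun z => f z + v * g z) u (df u + v * dg u)).
{ intros u v. apply (is_derive_plus (V := R_NormedModule) f (fun z => v * g z)); [apply Hf | ].
  apply is_derive_scal, Hg. }
assert (D2 : forall u v, is_derive (fun z => f u + z * g u) v (g u + v * 0)).
{ intros u v. auto_derive; [exact I | ring]. }
split; [ | split; [ | split; [ | split]]].
- now apply Hc.
- eexists. apply D1.
- eexists. apply D2.
- apply ex_diff_n_ext_loc with (fun u v => df u + v * dg u); [ | now apply IH].
  exists (mkposreal 1 Rlt_0_1). intros u v _ _. symmetry. apply is_derive_unique, D1.
- apply ex_diff_n_ext_loc with (fun u v => g u + v * 0).
  + exists (mkposreal 1 Rlt_0_1). intros u v _ _. symmetry. apply is_derive_unique, D2.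
  + apply (IH g (fun _ => 0)); auto using smooth_const.
Qed.

(** * The profile equation *)

(* [w = c - 2 tau x] is the vertical component of the Killing field of the tilted
   translations; [speed w x'] is the area element of the surface when the profile
   is parametrized by arc length. *)
Definition speed (w x1 : R) : R := sqrt (1 + (w * x1) * (w * x1)).

(* Curvature of the profile, as a curve of the (x, z)-plane, of a translator. *)
Definition profile_curvature (tau lambda w x1 z1 : R) : R :=
  (2 * (speed w x1 * speed w x1) * (x1 + lambda * speed w x1)
   + - 2 * tau * w * z1 * (x1 * x1)) * / (1 + w * w).

Lemma speed_ge1 w a : 1 <= speed w a.
Proof.
unfold speed. rewrite <- sqrt_1 at 1. apply sqrt_le_1_alt.
assert (0 <= (w * a) * (w * a)) by nra. lra.
Qed.

Lemma speed_sq w a : speed w a * speed w a = 1 + (w * a) * (w * a).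
Proof. unfold speed. apply sqrt_sqrt. nra. Qed.

(** The tilting is absent, so that one solution serves every c. The condition q 0 = 0 gives x' = 1
    at 0, from which the constructed surfaces are seen not to be vertical planes. *)
Theorem profile_exists tau lambda : exists w q z : R -> R,
  q 0 = 0 /\
  (forall s, is_derive w s (- 2 * tau * cos (q s))) /\
  (forall s, is_derive q s
     (profile_curvature tau lambda (w s) (cos (q s)) (sin (q s)))) /\
  (forall s, is_derive z s (sin (q s))) /\
  forall n, smooth n w /\ smooth n q /\ smooth n z.
Proof.
set (F := fun (i : bool) w q => if i then - 2 * tau * cos q
          else profile_curvature tau lambda w (cos q) (sin q)).
destruct (picard_lindelof F (Rabs (- 2 * tau))) as [u [H0 Hu]].
- intros w q. unfold F. rewrite Rabs_mult.
  assert (Rabs (cos q) <= 1) by (apply Rabs_le, COS_bound).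
  assert (H' := Rabs_pos (-2 * tau)). nra.
- intros M.
  assert (Hw2 : forall k, bounded_lipschitz M (fun w q => w * k q) ->
     bounded_lipschitz M (fun w q => 1 + (w * k q) * (w * k q))).
  { intros k Hk. apply bounded_lipschitz_plus;
      [apply bounded_lipschitz_const | now apply bounded_lipschitz_mult]. }
  assert (HW : bounded_lipschitz M (fun w q => speed w (cos q))).
  { apply bounded_lipschitz_sqrt; [intros; nra | ].
    apply Hw2, bounded_lipschitz_mult;
      [apply bounded_lipschitz_fst | apply bounded_lipschitz_cos]. }
  intros [ | ]; unfold F, profile_curvature.
  + repeat first [apply bounded_lipschitz_cos | apply bounded_lipschitz_const
                 | apply bounded_lipschitz_mult].
  + apply bounded_lipschitz_mult.
    * repeat first [exact HW | apply bounded_lipschitz_cos | apply bounded_lipschitz_sin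
         | apply bounded_lipschitz_const | apply bounded_lipschitz_fst
         | apply bounded_lipschitz_plus | apply bounded_lipschitz_mult].
    * apply bounded_lipschitz_inv; [intros; nra | ].
      repeat first [apply bounded_lipschitz_const | apply bounded_lipschitz_fst
         | apply bounded_lipschitz_plus | apply bounded_lipschitz_mult].
- set (w := u true). set (q := u false). fold w q in Hu.
  (* Bootstrap: if w and q are of class C^n, so are the right-hand sides of their equations, and w
     and q are of class C^(n+1). *)
  assert (Hwq : forall n, smooth n w /\ smooth n q).
  { induction n as [ | n [IHw IHq]].
    - split; intros x; apply (ex_derive_continuous (V := R_NormedModule));
        [exists (F true (w x) (q x)); apply (Hu true)
        | exists (F false (w x) (q x)); apply (Hu false)].
    - destruct (smooth_sin_cos n q IHq) as [Hs Hc].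
      assert (HW : smooth n (fun s => speed (w s) (cos (q s)))).
      { apply smooth_sqrt; [intros; nra | ].
        apply smooth_plus; [apply smooth_const | ].
        apply smooth_mult; now apply smooth_mult. }
      split.
      + exists (fun s => F true (w s) (q s)). split; [apply (Hu true) | ].
        apply smooth_mult; [apply smooth_const | assumption].
      + exists (fun s => F false (w s) (q s)). split; [apply (Hu false) | ].
        unfold F, profile_curvature. apply smooth_mult.
        * repeat first [assumption | apply smooth_const | apply smooth_plus
            | apply smooth_mult].
        * apply smooth_inv; [intros; nra | ].
          repeat first [assumption | apply smooth_const | apply smooth_plus
               | apply smooth_mult]. }
  assert (Hz : forall s, is_derive (RInt (fun r => sin (q r)) 0) s (sin (q s))).
  { intros s. apply (is_derive_RInt_from_0 (fun r => sin (q r))).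
    apply (proj1 (smooth_sin_cos 0 q (proj2 (Hwq 0%nat)))). }
  exists w, q, (RInt (fun r => sin (q r)) 0).
  split; [apply (H0 false) | ]. split; [apply (Hu true) | ].
  split; [apply (Hu false) | ]. split; [exact Hz | ].
  intros n. destruct (Hwq n) as [Hw Hq]. repeat split; auto.
  apply smooth_pred. exists (fun s => sin (q s)). split; [exact Hz | ].
  now apply smooth_sin_cos.
Qed.

(** * The mean curvature of invariant surfaces *)

Lemma triple_eq (a b d a' b' d' : R) : a = a' -> b = b' -> d = d' -> (a, b, d) = (a', b', d').
Proof. intros; subst; reflexivity. Qed.

Lemma Derive_eta (f : R -> R) (x l : R) : is_derive f x l -> Derive (fun r : R => f r) x = l.
Proof. apply is_derive_unique. Qed.

(* Derivative of [metric tau p v w] when [p] moves in the direction [e]. *)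
Definition metric_deriv (tau : R) (p e v w : R3) : R :=
  tau * (cy e * cx v - cx e * cy v) * (cz w + tau * (cy p * cx w - cx p * cy w))
  + (cz v + tau * (cy p * cx v - cx p * cy v)) * (tau * (cy e * cx w - cx e * cy w)).

Lemma partial_metric_coef tau i a b p :
  partial i (metric_coef tau a b) p = metric_deriv tau p (basis i) (basis a) (basis b).
Proof.
apply is_derive_unique. unfold metric_coef, metric, metric_deriv, add3, scal3.
destruct p as [[px py] pz].
destruct i, a, b; cbn -[Rmult Rplus Rminus]; auto_derive; auto; ring.
Qed.

(** Koszul's formula: contracted with [N], [V] and [W], the Christoffel symbols become directional
    derivatives of the metric coefficients. *)
Lemma second_formE tau p V W D N :
  second_form tau p V W D N =
  metric tau p D N + (metric_deriv tau p V N W + metric_deriv tau p W N V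
                      - metric_deriv tau p N V W) / 2.
Proof.
unfold second_form, sum_axes, christoffel. rewrite !partial_metric_coef.
destruct p as [[p1 p2] p3], V as [[v1 v2] v3], W as [[w1 w2] w3], N as [[n1 n2] n3].
unfold metric_deriv. cbn -[Rmult Rplus Rminus]. field.
Qed.

(** The point (x s, 0, z s) translated by [tilted_line c (y s + t)]. The shift y is there because an
    arbitrary invariant parametrization need not cross the plane y = 0 at t = 0. *)
Definition swept (tau c : R) (x y z : R -> R) : surface := fun s t =>
  (x s, y s + t, z s + c * (y s + t) - tau * (y s + t) * x s).

(* Components of the normal in the orthonormal frame
   [d_x - tau y d_z, d_y + tau x d_z, d_z], converted to coordinates at a point
   whose first two coordinates are [x] and [y]. *)
Definition swept_normal (tau x y w x1 z1 : R) : R3 :=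
  let n1 := - z1 / speed w x1 in
  let n2 := - (x1 * w) / speed w x1 in
  let n3 := x1 / speed w x1 in
  (n1, n2, n3 - tau * y * n1 + tau * x * n2).

Section Swept.

Variables (tau c : R) (x y z x1 y1 z1 x2 y2 z2 : R -> R) (psi : surface).
Hypothesis psi_eq : forall s t, psi s t = swept tau c x y z s t.
Hypotheses (Dx : forall s, is_derive x s (x1 s)) (Dy : forall s, is_derive y s (y1 s))
  (Dz : forall s, is_derive z s (z1 s)) (Dx1 : forall s, is_derive x1 s (x2 s))
  (Dy1 : forall s, is_derive y1 s (y2 s)) (Dz1 : forall s, is_derive z1 s (z2 s)).
Hypothesis arc_length : forall s, x1 s * x1 s + z1 s * z1 s = 1.

Let w s := c - 2 * tau * x s.

Lemma d_s_swept s t : d_s psi s t =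
  (x1 s, y1 s, z1 s + c * y1 s - tau * (y1 s * x s + (y s + t) * x1 s)).
Proof.
apply triple_eq.
- rewrite (Derive_ext _ x) by (intros; rewrite psi_eq; reflexivity).
  apply is_derive_unique, Dx.
- rewrite (Derive_ext _ (fun s => y s + t)) by (intros; rewrite psi_eq; reflexivity).
  apply is_derive_unique. auto_derive.
  + repeat split. eexists. apply Dy.
  + rewrite (Derive_eta y s _ (Dy s)). ring.
- rewrite (Derive_ext _ (fun s => z s + c * (y s + t) - tau * (y s + t) * x s))
    by (intros; rewrite psi_eq; reflexivity).
  apply is_derive_unique. auto_derive.
  + repeat split; eexists; [apply Dz | apply Dy | apply Dy | apply Dx].
  + rewrite (Derive_eta z s _ (Dz s)),
      (Derive_eta y s _ (Dy s)),
      (Derive_eta x s _ (Dx s)). ring.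
Qed.

Lemma d_t_swept s t : d_t psi s t = (0, 1, c - tau * x s).
Proof.
apply triple_eq; apply is_derive_unique.
- apply (is_derive_ext (fun _ => x s)); [intros; rewrite psi_eq; reflexivity | ].
  apply (is_derive_const (V := R_NormedModule)).
- apply (is_derive_ext (fun t => y s + t)); [intros; rewrite psi_eq; reflexivity | ].
  auto_derive; [exact I | ring].
- apply (is_derive_ext (fun t => z s + c * (y s + t) - tau * (y s + t) * x s));
    [intros; rewrite psi_eq; reflexivity | ].
  auto_derive; [exact I | ring].
Qed.

Lemma d_ss_swept s t : d_s (d_s psi) s t =
  (x2 s, y2 s, z2 s + c * y2 s
     - tau * (y2 s * x s + 2 * y1 s * x1 s + (y s + t) * x2 s)).
Proof.
apply triple_eq.
- rewrite (Derive_ext _ x1) by (intros; rewrite d_s_swept; reflexivity).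
  apply is_derive_unique, Dx1.
- rewrite (Derive_ext _ y1) by (intros; rewrite d_s_swept; reflexivity).
  apply is_derive_unique, Dy1.
- rewrite (Derive_ext _ (fun s => z1 s + c * y1 s - tau * (y1 s * x s + (y s + t) * x1 s)))
    by (intros; rewrite d_s_swept; reflexivity).
  apply is_derive_unique. auto_derive.
  + repeat split; eexists;
      [apply Dz1 | apply Dy1 | apply Dy1 | apply Dx | apply Dy | apply Dx1].
  + rewrite (Derive_eta z1 s _ (Dz1 s)),
      (Derive_eta y1 s _ (Dy1 s)),
      (Derive_eta x1 s _ (Dx1 s)),
      (Derive_eta y s _ (Dy s)),
      (Derive_eta x s _ (Dx s)). ring.
Qed.

Lemma d_st_swept s t : d_s (d_t psi) s t = (0, 0, - tau * x1 s).
Proof.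
apply triple_eq; apply is_derive_unique.
- apply (is_derive_ext (fun _ => 0)); [intros; rewrite d_t_swept; reflexivity | ].
  apply (is_derive_const (V := R_NormedModule)).
- apply (is_derive_ext (fun _ => 1)); [intros; rewrite d_t_swept; reflexivity | ].
  apply (is_derive_const (V := R_NormedModule)).
- apply (is_derive_ext (fun s => c - tau * x s)); [intros; rewrite d_t_swept; reflexivity | ].
  auto_derive.
  + repeat split; eexists; apply Dx.
  + rewrite (Derive_eta x s _ (Dx s)). ring.
Qed.

Lemma d_tt_swept s t : d_t (d_t psi) s t = (0, 0, 0).
Proof.
apply triple_eq; apply is_derive_unique;
  [apply (is_derive_ext (fun _ => 0)) | apply (is_derive_ext (fun _ => 1))
  | apply (is_derive_ext (fun _ => c - tau * x s))];
  try (intros; rewrite d_t_swept; reflexivity);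
  apply (is_derive_const (V := R_NormedModule)).
Qed.

Lemma mean_curvature_swept N eps s t :
  N s t = scal3 eps (swept_normal tau (x s) (y s + t) (w s) (x1 s) (z1 s)) ->
  mean_curvature tau psi N s t =
  eps * ((x1 s * z2 s - z1 s * x2 s) * (1 + w s * w s)
         + 2 * tau * w s * z1 s * (x1 s * x1 s))
  / (2 * (speed (w s) (x1 s) * speed (w s) (x1 s) * speed (w s) (x1 s))).
Proof.
intros HN. unfold mean_curvature. cbv zeta.
rewrite d_s_swept, d_t_swept, d_ss_swept, d_st_swept, d_tt_swept, !second_formE, psi_eq, HN.
unfold swept, swept_normal, metric_deriv, metric, scal3.
cbn [cx cy cz fst snd].
assert (HW := speed_sq (w s) (x1 s)). assert (HW1 := speed_ge1 (w s) (x1 s)).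
assert (Ha := arc_length s).
assert (Hx : tau * x s = (c - w s) / 2) by (unfold w; field).
assert (Hc : c = w s + 2 * tau * x s) by (unfold w; ring).
set (W := speed (w s) (x1 s)) in *. clearbody W.
clear HN. generalize dependent (w s). intros v HW Hx Hc.
clear Hx. rewrite Hc.
clear Hc.
generalize dependent (z1 s). generalize (x s) (x2 s) (y s + t) (y1 s) (y2 s) (z s) (z2 s).
generalize dependent (x1 s). intros a1 HW a a2 b b1 b2 d d2 d1 Ha.
(* [Den] is EG - F^2, the square of the area element W. The normal brings a factor 1/W, hence the
   polynomial identity for [W * Num], in which the shift y and its derivatives cancel. The
   intermediate expressions display x'^2 + z'^2, so that [ring] proves one side and the arc-length
   relation the other. *)
match goal with |- ?num / ?den / 2 = _ =>
  set (Num := num); set (Den := den)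
end.
assert (HDen : Den = W * W).
{ transitivity (1 + v * v * (1 - d1 * d1) + (a1 * a1 + d1 * d1 - 1) * (1 + v * v)).
  - unfold Den. ring.
  - rewrite HW. replace (1 - d1 * d1) with (a1 * a1) by lra. rewrite Ha. ring. }
assert (HNum : W * Num = eps * ((a1 * d2 - d1 * a2) * (1 + v * v) + 2 * tau * v * d1 * (a1 * a1))).
{ transitivity (eps * ((a1 * d2 - d1 * a2) * (1 + v * v) + 2 * tau * v * d1 *
    (a1 * a1 * (1 + v * v) - (v * v * (a1 * a1) - (a1 * a1 + d1 * d1)) - (a1 * a1 + d1 * d1)))).
  - unfold Num. field. lra.
  - rewrite Ha. ring. }
rewrite HDen. apply Rmult_eq_reg_l with (W * W * W * 2); [ | nra].
transitivity (W * Num); [field; lra | ]. rewrite HNum. field. lra.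
Qed.

(** In the orthonormal frame N must be eps (-z', -w x', x') / W, and pairing it with (-z', 0, x')
    gives eps / W. The sign is given by this formula because its continuity in s will show that it
    is constant. *)
Lemma unit_normal_swept N s t :
  metric tau (psi s t) (N s t) (N s t) = 1 ->
  metric tau (psi s t) (N s t) (d_s psi s t) = 0 ->
  metric tau (psi s t) (N s t) (d_t psi s t) = 0 ->
  let eps := speed (w s) (x1 s) *
    ((cz (N s t) + tau * ((y s + t) * cx (N s t) - x s * cy (N s t))) * x1 s
     - cx (N s t) * z1 s) in
  eps * eps = 1 /\
  N s t = scal3 eps (swept_normal tau (x s) (y s + t) (w s) (x1 s) (z1 s)).
Proof.
rewrite d_s_swept, d_t_swept, psi_eq.
unfold swept, swept_normal, metric, scal3.
destruct (N s t) as [[n1 n2] n3]. cbn [cx cy cz fst snd].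
assert (HW := speed_sq (w s) (x1 s)). assert (HW1 := speed_ge1 (w s) (x1 s)).
assert (Ha := arc_length s).
assert (Hc : c = w s + 2 * tau * x s) by (unfold w; ring).
set (W := speed (w s) (x1 s)) in *. clearbody W.
generalize dependent (w s). intros v HW Hc.
rewrite Hc.
generalize (x s) (x1 s) (y s + t) (y1 s) (z1 s) Ha HW.
clear -HW1. intros a a1 b b1 d1 Ha HW H1 H2 H3.
set (m3 := n3 + tau * (b * n1 - a * n2)) in *.
assert (E2 : n2 = - v * m3).
{ assert (E : n2 + v * m3 = 0) by (rewrite <- H3; ring). lra. }
assert (E0 : n1 * a1 + m3 * d1 = 0).
{ transitivity (n1 * a1 + n2 * b1 +
   m3 * (d1 + (v + 2 * tau * a) * b1 - tau * (b1 * a + b * a1) + tau * (b * a1 - a * b1))).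
  - rewrite E2. ring.
  - exact H2. }
set (m := m3 * a1 - n1 * d1).
assert (E3 : m3 = m * a1).
{ unfold m. transitivity (m3 * (a1 * a1 + d1 * d1) - d1 * (n1 * a1 + m3 * d1)); [ | ring].
  rewrite Ha, E0. ring. }
assert (E1 : n1 = - m * d1).
{ unfold m. transitivity (n1 * (a1 * a1 + d1 * d1) - a1 * (n1 * a1 + m3 * d1)); [ | ring].
  rewrite Ha, E0. ring. }
assert (Em : m * m * (W * W) = 1).
{ rewrite HW. transitivity (m * m * (a1 * a1 + d1 * d1) + v * m * a1 * (v * m * a1)).
  - rewrite Ha. ring.
  - rewrite <- H1. rewrite E2, E1, E3. ring. }
split.
- rewrite <- Em. ring.
- apply triple_eq.
  + rewrite E1 at 1. field. lra.
  + rewrite E2, E3. field. lra.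
  + replace n3 with (m3 - tau * b * n1 + tau * a * n2) by (unfold m3; ring).
    rewrite E2. rewrite E3 at 1 2. rewrite E1 at 1. field. lra.
Qed.

Lemma angle_swept N eps s t :
  N s t = scal3 eps (swept_normal tau (x s) (y s + t) (w s) (x1 s) (z1 s)) ->
  angle_function tau psi N s t = eps * x1 s / speed (w s) (x1 s).
Proof.
intros HN. unfold angle_function. rewrite HN, psi_eq.
unfold swept, swept_normal, metric, scal3, basis. cbn [cx cy cz fst snd].
assert (HW1 := speed_ge1 (w s) (x1 s)). field. lra.
Qed.

Lemma translator_swept lambda N eps s t :
  eps * eps = 1 ->
  N s t = scal3 eps (swept_normal tau (x s) (y s + t) (w s) (x1 s) (z1 s)) ->
  mean_curvature tau psi N s t = angle_function tau psi N s t + lambda <->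
  x1 s * z2 s - z1 s * x2 s =
    profile_curvature tau (eps * lambda) (w s) (x1 s) (z1 s).
Proof.
intros He HN. rewrite (mean_curvature_swept N eps s t HN), (angle_swept N eps s t HN).
unfold profile_curvature.
assert (HW1 := speed_ge1 (w s) (x1 s)).
set (W := speed (w s) (x1 s)) in *. clearbody W.
generalize (w s) (x1 s) (z1 s) (x1 s * z2 s - z1 s * x2 s). clear -He HW1.
intros v a d k.
assert (Hv : 0 < 1 + v * v) by nra.
assert (HW3 : 0 < W * W * W) by (repeat apply Rmult_lt_0_compat; lra).
assert (He0 : eps <> 0) by (intros H; rewrite H in He; lra).
split; intros H.
- apply Rmult_eq_reg_l with (1 + v * v); [ | lra].
  apply Rmult_eq_reg_l with eps; [ | assumption].
  apply Rmult_eq_compat_l with (r := 2 * (W * W * W)) in H.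
  transitivity (eps * (k * (1 + v * v) + 2 * tau * v * d * (a * a))
                - eps * (2 * tau * v * d * (a * a))); [ring | ].
  transitivity (2 * (W * W) * (eps * a + lambda * W) - eps * (2 * tau * v * d * (a * a))).
  + f_equal. transitivity (2 * (W * W * W) * (eps * a / W + lambda)).
    * rewrite <- H. field. lra.
    * field. lra.
  + transitivity (2 * (W * W) * (eps * a + (eps * eps) * lambda * W)
                  - eps * (2 * tau * v * d * (a * a))); [rewrite He; ring | ].
    field. lra.
- rewrite H. transitivity (eps * a / W + (eps * eps) * lambda);
    [field; split; nra | rewrite He; ring].
Qed.

End Swept.

(** * Existence of a grim reaper for every tilting *)

Lemma ex_diff_n_affine_ext n (F : R -> R -> R) (f g : R -> R) :
  (forall u v, F u v = f u + v * g u) -> smooth n f -> smooth n g ->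
  forall x y, ex_diff_n F n x y.
Proof.
intros HF Hf Hg x y.
apply ex_diff_n_ext_loc with (fun u v => f u + v * g u); [ | now apply ex_diff_n_affine].
exists (mkposreal 1 Rlt_0_1). intros u v _ _. now rewrite HF.
Qed.

Lemma continuity_2d_affine_ext (F : R -> R -> R) (f g : R -> R) :
  (forall u v, F u v = f u + v * g u) -> smooth 0 f -> smooth 0 g ->
  forall x y, continuity_2d_pt F x y.
Proof. intros HF Hf Hg x y. apply (ex_diff_n_affine_ext 0 F f g HF Hf Hg x y). Qed.

Lemma velocity_planar (alpha : R -> R3) (x z : R -> R) (s x1 z1 : R) :
  (forall r, alpha r = (x r, 0, z r)) -> is_derive x s x1 -> is_derive z s z1 ->
  velocity alpha s = (x1, 0, z1).
Proof.
intros Ha Hx Hz. apply triple_eq; apply is_derive_unique.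
- apply (is_derive_ext x); [intros; now rewrite Ha | exact Hx].
- apply (is_derive_ext (fun _ => 0)); [intros; now rewrite Ha | ].
  apply (is_derive_const (V := R_NormedModule)).
- apply (is_derive_ext z); [intros; now rewrite Ha | exact Hz].
Qed.

Lemma metric_planar tau a d a1 d1 :
  metric tau (a, 0, d) (a1, 0, d1) (a1, 0, d1) = a1 * a1 + d1 * d1.
Proof. unfold metric; cbn [cx cy cz fst snd]; ring. Qed.

Lemma profile_swept tau c x y z psi :
  (forall s t, psi s t = swept tau c x y z s t) ->
  forall s, profile_curve psi s = (x s, 0, z s).
Proof.
intros H s. unfold profile_curve. rewrite !H. unfold swept. cbn [cx cy cz fst snd].
apply triple_eq; ring.
Qed.

Lemma unit_normal_swept_normal tau x y b1 w x1 z1 zz :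
  x1 * x1 + z1 * z1 = 1 ->
  let p := (x, y, zz) in
  let N := swept_normal tau x y w x1 z1 in
  metric tau p N N = 1 /\
  metric tau p N (x1, b1, z1 + (w + 2 * tau * x) * b1 - tau * (b1 * x + y * x1)) = 0 /\
  metric tau p N (0, 1, w + 2 * tau * x - tau * x) = 0.
Proof.
intros Ha p N. unfold p, N, metric, swept_normal; cbn [cx cy cz fst snd].
assert (HW := speed_sq w x1). assert (HW1 := speed_ge1 w x1).
set (W := speed w x1) in *. clearbody W.
repeat split; [ | field; lra | field; lra].
apply Rmult_eq_reg_l with (W * W); [ | nra].
transitivity (x1 * x1 + z1 * z1 + w * x1 * (w * x1)); [field; lra | ].
rewrite Ha, HW. ring.
Qed.

Theorem grim_reapers_exist tau lambda : tau <> 0 ->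
  exists Psi N : R -> surface, forall c : R,
     grim_reaper tau lambda c (Psi c) (N c) /\
     exists s t : R, angle_function tau (Psi c) (N c) s t <> 0.
Proof.
intros Htau.
destruct (profile_exists tau lambda) as [w [q [z [q0 [Dw [Dq [Dz Hsm]]]]]]].
(* Solving w = c - 2 tau x for x: the profiles of the family are horizontal translates of one curve,
   and only the sweeping depends otherwise on c. *)
set (x := fun c s => (c + -1 * w s) / (2 * tau)).
exists (fun c => swept tau c (x c) (fun _ => 0) z),
  (fun c s t => swept_normal tau (x c s) (0 + t) (w s) (cos (q s)) (sin (q s))).
intros c.
set (psi := swept tau c (x c) (fun _ => 0) z).
set (N := fun s t => swept_normal tau (x c s) (0 + t) (w s) (cos (q s)) (sin (q s))).
set (k := fun s => profile_curvature tau lambda (w s) (cos (q s)) (sin (q s))).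
assert (psi_eq : forall s t, psi s t = swept tau c (x c) (fun _ => 0) z s t)
  by reflexivity.
assert (Dx : forall s, is_derive (x c) s (cos (q s))).
{ intros s. unfold x. auto_derive.
  - repeat split. eexists. apply Dw.
  - rewrite (Derive_eta w s _ (Dw s)). field. exact Htau. }
assert (D0 : forall a s, is_derive (fun _ : R => a) s 0)
  by (intros; apply (is_derive_const (V := R_NormedModule))).
assert (Dx1 : forall s, is_derive (fun s => cos (q s)) s (- k s * sin (q s))).
{ intros s. auto_derive.
  - repeat split. eexists. apply Dq.
  - rewrite (Derive_eta q s _ (Dq s)). fold (k s). ring. }
assert (Dz1 : forall s, is_derive (fun s => sin (q s)) s (k s * cos (q s))).
{ intros s. auto_derive.
  - repeat split. eexists. apply Dq.
  - rewrite (Derive_eta q s _ (Dq s)). fold (k s). ring. }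
assert (Ha : forall s, cos (q s) * cos (q s) + sin (q s) * sin (q s) = 1).
{ intros s. assert (H := sin2_cos2 (q s)). unfold Rsqr in H. lra. }
assert (Hw : forall s, c - 2 * tau * x c s = w s)
  by (intros s; unfold x; field; exact Htau).
assert (HN : forall s t, N s t = scal3 1 (swept_normal tau (x c s) (0 + t)
   (c - 2 * tau * x c s) (cos (q s)) (sin (q s)))).
{ intros s t. unfold N, scal3. rewrite Hw. unfold swept_normal. cbn [cx cy cz fst snd].
  apply triple_eq; ring. }
assert (Sx : forall n, smooth n (x c)).
{ intros n. apply smooth_mult; [ | apply smooth_const].
  apply smooth_plus; [apply smooth_const | ].
  apply smooth_mult; [apply smooth_const | apply Hsm]. }
assert (Hds := d_s_swept tau c (x c) (fun _ => 0) z _ _ _ psi psi_eq Dx (D0 0) Dz).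
assert (Hdt := d_t_swept tau c (x c) (fun _ => 0) z psi psi_eq).
split; [split; [ | split] | ].
- split; [ | split; [ | split]].
  + intros i n. destruct i.
    * apply ex_diff_n_affine_ext with (x c) (fun _ => 0); [ | apply Sx | apply smooth_const].
      intros. cbn. ring.
    * apply ex_diff_n_affine_ext with (fun _ => 0) (fun _ => 1);
        [ | apply smooth_const | apply smooth_const].
      intros. cbn. ring.
    * apply ex_diff_n_affine_ext with z (fun s => c + - tau * x c s).
      -- intros. cbn. ring.
      -- apply Hsm.
      -- apply smooth_plus; [apply smooth_const | ].
         apply smooth_mult; [apply smooth_const | apply Sx].
  + intros s t a b. rewrite Hds, Hdt. unfold add3, scal3. cbn [cx cy cz fst snd].
    intros H. injection H. intros H3 H2 H1.
    assert (Hb : b = 0) by lra. subst b.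
    assert (Ha' := Ha s). rewrite Rmult_0_l, Rplus_0_r in H1.
    assert (H4 : a * sin (q s) = 0).
    { replace (a * sin (q s)) with
        (a * (sin (q s) + c * 0 - tau * (0 * x c s + (0 + t) * cos (q s)))
          + 0 * (c - tau * x c s) + tau * (0 + t) * (a * cos (q s))) by ring.
      rewrite H3, H1. ring. }
    split; [ | reflexivity].
    transitivity ((a * cos (q s)) * cos (q s) + (a * sin (q s)) * sin (q s)).
    * rewrite !Rmult_assoc, <- Rmult_plus_distr_l, Ha'. ring.
    * rewrite H1, H4. ring.
  + split.
    * destruct (smooth_sin_cos 0 q (proj1 (proj2 (Hsm 0%nat)))) as [Ss Sc].
      assert (Sw := proj1 (Hsm 0%nat)).
      assert (SW : smooth 0 (fun s => / speed (w s) (cos (q s)))).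
      { apply smooth_inv.
        - intros s. assert (H := speed_ge1 (w s) (cos (q s))). lra.
        - apply smooth_sqrt; [intros; nra | ].
          repeat first [assumption | apply smooth_const | apply smooth_plus
            | apply smooth_mult]. }
      set (n1 := fun s => -1 * (sin (q s) * / speed (w s) (cos (q s)))).
      set (n2 := fun s => -1 * (cos (q s) * w s * / speed (w s) (cos (q s)))).
      assert (S1 : smooth 0 n1).
      { apply smooth_mult; [apply smooth_const | now apply smooth_mult]. }
      assert (S2 : smooth 0 n2).
      { apply smooth_mult; [apply smooth_const | apply smooth_mult; [ | assumption]].
        now apply smooth_mult. }
      assert (E1 : forall s, - sin (q s) / speed (w s) (cos (q s)) = n1 s).
      { intros s. unfold n1. assert (H := speed_ge1 (w s) (cos (q s))). field. lra. }
      assert (E2 : forall s, - (cos (q s) * w s) / speed (w s) (cos (q s)) = n2 s).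
      { intros s. unfold n2. assert (H := speed_ge1 (w s) (cos (q s))). field. lra. }
      intros i. unfold N, swept_normal.
      destruct i.
      -- apply continuity_2d_affine_ext with n1 (fun _ => 0);
           [ | assumption | apply smooth_const].
         intros u v. cbn. rewrite E1. ring.
      -- apply continuity_2d_affine_ext with n2 (fun _ => 0);
           [ | assumption | apply smooth_const].
         intros u v. cbn. rewrite E2. ring.
      -- apply continuity_2d_affine_ext with
           (fun s => cos (q s) * / speed (w s) (cos (q s)) + tau * (x c s * n2 s))
           (fun s => - tau * n1 s).
         ++ intros u v. cbn. rewrite E1, E2. unfold Rdiv. ring.
         ++ apply smooth_plus; [now apply smooth_mult | ].
            apply smooth_mult; [apply smooth_const | ].
            apply smooth_mult; [apply Sx | assumption].
         ++ apply smooth_mult; [apply smooth_const | assumption].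
    * intros s t. rewrite Hds, Hdt.
      assert (Hc : c = w s + 2 * tau * x c s) by (rewrite <- Hw; ring).
      assert (H := unit_normal_swept_normal tau (x c s) (0 + t) 0 (w s) (cos (q s))
        (sin (q s)) (cz (psi s t)) (Ha s)).
      cbv zeta in H. rewrite <- Hc in H. exact H.
  + intros s t.
    apply (translator_swept tau c (x c) (fun _ => 0) z _ _ _ _ _ _ psi psi_eq Dx (D0 0)
      Dz Dx1 (D0 0) Dz1 Ha lambda N 1 s t); [ring | apply HN | ].
    rewrite Hw. cbv beta.
    replace (1 * lambda) with lambda by ring. fold (k s).
    transitivity (k s * (cos (q s) * cos (q s) + sin (q s) * sin (q s))); [ring | ].
    rewrite Ha. ring.
- intros s t r. rewrite (psi_eq s t), (psi_eq s (t + r)). unfold swept, left_translation, nil_mul, tilted_line.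
  cbn [cx cy cz fst snd]. apply triple_eq; ring.
- intros s.
  assert (Hp := profile_swept tau c (x c) (fun _ => 0) z psi psi_eq).
  rewrite (velocity_planar _ (x c) z s (cos (q s)) (sin (q s)) Hp (Dx s) (Dz s)), Hp.
  rewrite metric_planar. apply Ha.
- exists 0, 0. assert (Hang := angle_swept tau c (x c) (fun _ => 0) z (fun s => cos (q s))
    (fun s => sin (q s)) psi psi_eq N 1 0 0 (HN 0 0)).
  cbv beta in Hang. fold psi N. rewrite Hang, q0, cos_0.
  assert (H := speed_ge1 (c - 2 * tau * x c 0) 1).
  apply Rgt_not_eq. apply Rdiv_lt_0_compat; lra.
Qed.

(** * From an arbitrary grim reaper to the equation of its profile *)

Lemma constant_sign (f : R -> R) :
  (forall x, continuity_pt f x) -> (forall x, f x * f x = 1) -> forall x, f x = f 0.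
Proof.
intros Hf H1.
assert (H : forall a b, ~ (f a = 1 /\ f b = -1)).
{ intros a b [Ha Hb].
  destruct (IVT_gen f a b 0 Hf) as [r [_ Hr]].
  - rewrite Ha, Hb, Rmin_right, Rmax_left; lra.
  - specialize (H1 r). rewrite Hr in H1. lra. }
assert (Hpm : forall a, f a = 1 \/ f a = -1).
{ intros a. specialize (H1 a). assert (Hz : (f a - 1) * (f a + 1) = 0) by lra.
  apply Rmult_integral in Hz. lra. }
intros a. destruct (Hpm a) as [Ea | Ea], (Hpm 0) as [E0 | E0]; try lra;
  exfalso; eapply H; eauto.
Qed.

(* A unit-speed plane curve [(x, z)] which is the profile of a [lambda]-grim
   reaper of tilting [c], for one of its two orientations. *)
Record profile (tau lambda c : R) (x z x1 z1 : R -> R) : Prop := {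
  profile_x : forall s, is_derive x s (x1 s);
  profile_z : forall s, is_derive z s (z1 s);
  profile_unit : forall s, x1 s * x1 s + z1 s * z1 s = 1;
  profile_x1 : forall s, is_derive x1 s
    (- profile_curvature tau lambda (c - 2 * tau * x s) (x1 s) (z1 s) * z1 s);
  profile_z1 : forall s, is_derive z1 s
    (profile_curvature tau lambda (c - 2 * tau * x s) (x1 s) (z1 s) * x1 s)
}.

Theorem grim_reaper_profile tau lambda c psi N :
  grim_reaper tau lambda c psi N ->
  exists eps x z x1 z1, (eps = 1 \/ eps = -1) /\
    (forall s, profile_curve psi s = (x s, 0, z s)) /\
    profile tau (eps * lambda) c x z x1 z1.
Proof.
intros [[Hsm [_ [[HNc HN] HH]]] [Htilt Hunit]].
set (X := fun i s => coord i (psi s 0)).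
set (X1 := fun i => Derive (X i)). set (X2 := fun i => Derive (X1 i)).
assert (DX : forall i s, is_derive (X i) s (X1 i s)).
{ intros i s. apply Derive_correct. apply (Hsm i 1%nat s 0). }
assert (DX1 : forall i s, is_derive (X1 i) s (X2 i s)).
{ intros i s. apply Derive_correct.
  destruct (Hsm i 2%nat s 0) as [_ [_ [_ [H _]]]]. apply H. }
set (x := X axis_x). set (y := X axis_y).
set (z0 := X axis_z).
(* The height at which the orbit crosses y = 0: the point at t = 0 is translated back by y s along
   the tilted line. *)
set (z := fun s => z0 s - c * y s + tau * x s * y s).
assert (Dx := DX axis_x). assert (Dy := DX axis_y). assert (Dz0 := DX axis_z).
assert (Dx1 := DX1 axis_x). assert (Dy1 := DX1 axis_y). assert (Dz01 := DX1 axis_z).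
fold x in Dx. fold y in Dy. fold z0 in Dz0.
set (x1 := X1 axis_x) in *. set (y1 := X1 axis_y) in *.
set (x2 := X2 axis_x) in *. set (y2 := X2 axis_y) in *.
set (z01 := X1 axis_z) in *.
set (z1 := fun s => z01 s - c * y1 s + tau * (x1 s * y s + x s * y1 s)).
set (z2 := fun s => X2 axis_z s - c * y2 s
  + tau * (x2 s * y s + 2 * x1 s * y1 s + x s * y2 s)).
assert (Dz : forall s, is_derive z s (z1 s)).
{ intros s. unfold z, z1. auto_derive.
  - repeat split; eexists; [apply Dz0 | apply Dy | apply Dx | apply Dy].
  - rewrite (Derive_eta z0 s _ (Dz0 s)), (Derive_eta x s _ (Dx s)),
      (Derive_eta y s _ (Dy s)). ring. }
assert (Dz1 : forall s, is_derive z1 s (z2 s)).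
{ intros s. unfold z1, z2. auto_derive.
  - repeat split; eexists;
      [apply Dz01 | apply Dy1 | apply Dx1 | apply Dy | apply Dx | apply Dy1].
  - rewrite (Derive_eta z01 s _ (Dz01 s)), (Derive_eta x1 s _ (Dx1 s)),
      (Derive_eta y1 s _ (Dy1 s)), (Derive_eta x s _ (Dx s)),
      (Derive_eta y s _ (Dy s)). ring. }
assert (psi_eq : forall s t, psi s t = swept tau c x y z s t).
{ intros s t. rewrite <- (Rplus_0_l t) at 1. rewrite Htilt.
  unfold swept, left_translation, nil_mul, tilted_line, z, z0, x, y, X.
  cbn [cx cy cz fst snd coord]. apply triple_eq; ring. }
assert (Hp := profile_swept tau c x y z psi psi_eq).
assert (Ha : forall s, x1 s * x1 s + z1 s * z1 s = 1).
{ intros s. specialize (Hunit s).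
  rewrite (velocity_planar _ x z s (x1 s) (z1 s) Hp (Dx s) (Dz s)), Hp,
    metric_planar in Hunit. exact Hunit. }
set (w := fun s => c - 2 * tau * x s).
set (eps := fun s => speed (w s) (x1 s) *
    ((cz (N s 0) + tau * ((y s + 0) * cx (N s 0) - x s * cy (N s 0))) * x1 s
     - cx (N s 0) * z1 s)).
assert (He : forall s, eps s * eps s = 1 /\
  N s 0 = scal3 (eps s) (swept_normal tau (x s) (y s + 0) (w s) (x1 s) (z1 s))).
{ intros s. destruct (HN s 0) as [H1 [H2 H3]].
  exact (unit_normal_swept tau c x y z x1 y1 z1 psi psi_eq Dx Dy Dz Ha N s 0 H1 H2 H3). }
assert (Hcont : forall s, continuity_pt eps s).
{ intros s.
  assert (CN : forall i, continuity_pt (fun r => coord i (N r 0)) s).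
  { intros i. apply continuity_pt_filterlim, filterlim_locally. intros e.
    destruct (HNc i s 0 e) as [d Hd]. exists d. intros r Hr.
    apply Hd; [exact Hr | rewrite Rminus_diag, Rabs_R0; apply cond_pos]. }
  assert (Cx := is_derive_continuity _ _ _ (Dx s)).
  assert (Cy := is_derive_continuity _ _ _ (Dy s)).
  assert (Cx1 := is_derive_continuity _ _ _ (Dx1 s)).
  assert (Cz1 := is_derive_continuity _ _ _ (Dz1 s)).
  assert (C0 : forall a : R, continuity_pt (fun _ => a) s)
    by (intros; now apply continuity_pt_const).
  assert (Cw : continuity_pt w s).
  { apply (continuity_pt_minus (fun _ => c) (fun s => 2 * tau * x s)); [apply C0 | ].
    now apply (continuity_pt_mult (fun _ => 2 * tau) x). }
  assert (Cwx := continuity_pt_mult w x1 s Cw Cx1).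
  assert (CW : continuity_pt (fun s => speed (w s) (x1 s)) s).
  { apply (continuity_pt_comp (fun s => 1 + w s * x1 s * (w s * x1 s)) sqrt).
    - apply (continuity_pt_plus (fun _ => 1)); [apply C0 | ].
      now apply (continuity_pt_mult _ _ s).
    - apply continuity_pt_sqrt. nra. }
  assert (C1 := CN axis_x). assert (C2 := CN axis_y). assert (C3 := CN axis_z).
  apply (continuity_pt_mult _ _ s CW).
  apply (continuity_pt_minus (fun s => _ * x1 s)).
  - apply (continuity_pt_mult _ x1); [ | exact Cx1].
    apply (continuity_pt_plus _ _ s C3).
    apply (continuity_pt_mult (fun _ => tau)); [apply C0 | ].
    apply (continuity_pt_minus (fun s => (y s + 0) * cx (N s 0))).
    + apply (continuity_pt_mult (fun s => y s + 0)); [ | exact C1].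
      apply (continuity_pt_plus y (fun _ => 0)); auto.
    + apply (continuity_pt_mult x _ s Cx C2).
  - apply (continuity_pt_mult _ _ s C1 Cz1). }
assert (Heps : forall s, eps s = eps 0).
{ apply constant_sign; [exact Hcont | intros s; apply He]. }
exists (eps 0), x, z, x1, z1. split; [ | split; [exact Hp | ]].
{ destruct (He 0) as [H _]. assert (Hz : (eps 0 - 1) * (eps 0 + 1) = 0) by lra.
  apply Rmult_integral in Hz. lra. }
assert (Hk : forall s, x1 s * z2 s - z1 s * x2 s =
  profile_curvature tau (eps 0 * lambda) (w s) (x1 s) (z1 s)).
{ intros s. destruct (He s) as [H1 H2]. rewrite <- (Heps s).
  apply (proj1 (translator_swept tau c x y z x1 y1 z1 x2 y2 z2 psi psi_eq Dx Dy Dz Dx1 Dy1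
    Dz1 Ha lambda N (eps s) s 0 H1 H2)). apply HH. }
(* [Hk] gives only the normal part of the acceleration; differentiating the unit speed shows that
   the tangential part is 0, and the two determine x'' and z''. *)
assert (Horth : forall s, x1 s * x2 s + z1 s * z2 s = 0).
{ intros s.
  assert (HD : is_derive (fun s => x1 s * x1 s + z1 s * z1 s) s
    (2 * (x1 s * x2 s + z1 s * z2 s))).
  { auto_derive.
    - repeat split; eexists; [apply Dx1 | apply Dx1 | apply Dz1 | apply Dz1].
    - rewrite (Derive_eta x1 s _ (Dx1 s)), (Derive_eta z1 s _ (Dz1 s)). ring. }
  apply is_derive_unique in HD.
  rewrite (Derive_ext _ (fun _ => 1)), Derive_const in HD by apply Ha. lra. }
split; auto.
- intros s. fold (w s). rewrite <- Hk.
  replace (- (x1 s * z2 s - z1 s * x2 s) * z1 s) with (x2 s); [apply Dx1 | ].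
  transitivity (x2 s * (x1 s * x1 s + z1 s * z1 s)
    - x1 s * (x1 s * x2 s + z1 s * z2 s)); [rewrite Ha, Horth; ring | ring].
- intros s. fold (w s). rewrite <- Hk.
  replace ((x1 s * z2 s - z1 s * x2 s) * x1 s) with (z2 s); [apply Dz1 | ].
  transitivity (z2 s * (x1 s * x1 s + z1 s * z1 s)
    - z1 s * (x1 s * x2 s + z1 s * z2 s)); [rewrite Ha, Horth; ring | ring].
Qed.

(** * Loops of the profile *)

Section Dynamics.

Variables (tau lambda c : R) (x z x1 z1 : R -> R).
Hypothesis tau_neq0 : tau <> 0.
Hypothesis lambda_pos : 0 < lambda.
Hypothesis Hprof : profile tau lambda c x z x1 z1.

Let w s := c - 2 * tau * x s.
Let W s := speed (w s) (x1 s).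
Let k s := profile_curvature tau lambda (w s) (x1 s) (z1 s).

Definition flux_slope (s : R) : R := z1 s / W s.
Let S := flux_slope.

Let Dx := profile_x _ _ _ _ _ _ _ Hprof.
Let Dz := profile_z _ _ _ _ _ _ _ Hprof.
Let Ha := profile_unit _ _ _ _ _ _ _ Hprof.
Let Dx1 : forall s, is_derive x1 s (- k s * z1 s) := profile_x1 _ _ _ _ _ _ _ Hprof.
Let Dz1 : forall s, is_derive z1 s (k s * x1 s) := profile_z1 _ _ _ _ _ _ _ Hprof.

Lemma W_ge1 s : 1 <= W s.
Proof. apply speed_ge1. Qed.

Lemma W_sq s : W s * W s = 1 + w s * x1 s * (w s * x1 s).
Proof. apply speed_sq. Qed.

Lemma w_derive s : is_derive w s (- 2 * tau * x1 s).
Proof.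
unfold w. auto_derive.
- eexists; apply Dx.
- rewrite (Derive_eta x s _ (Dx s)). ring.
Qed.

Lemma W_derive s : is_derive W s
  (w s * x1 s * (- 2 * tau * x1 s * x1 s - w s * (k s * z1 s)) / W s).
Proof.
assert (HW1 := W_ge1 s).
assert (D : is_derive (fun s => w s * x1 s) s
  (- 2 * tau * x1 s * x1 s + w s * (- k s * z1 s))).
{ apply (is_derive_mult (K := R_AbsRing)); [apply w_derive | apply Dx1 | ].
  intros; apply Rmult_comm. }
set (u := fun s => w s * x1 s) in D.
assert (D1 : is_derive (fun s => 1 + u s * u s) s
  (2 * u s * (- 2 * tau * x1 s * x1 s + w s * (- k s * z1 s)))).
{ auto_derive.
  - repeat split; eexists; apply D.
  - rewrite (Derive_eta u s _ D). ring. }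
apply is_derive_sqrt in D1; [ | unfold u; nra].
change (is_derive W s (2 * u s * (- 2 * tau * x1 s * x1 s + w s * (- k s * z1 s))
  / (2 * W s))) in D1.
replace (w s * x1 s * (- 2 * tau * x1 s * x1 s - w s * (k s * z1 s)) / W s)
  with (2 * u s * (- 2 * tau * x1 s * x1 s + w s * (- k s * z1 s)) / (2 * W s)).
- exact D1.
- unfold u. field. lra.
Qed.

(** The derivative of W contributes w^2 z'^2 k, which completes k W^2 to k (1 + w^2). The quotient
    rule thus yields x' / W^3 times the left-hand side of the translator equation, which is 2 W^2
    (x' + lambda W). *)
Lemma S_derive s : is_derive S s (2 * x1 s * (x1 s / W s + lambda)).
Proof.
assert (HW1 := W_ge1 s). assert (HW := W_sq s).
assert (HW0 : W s <> 0) by lra.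
assert (D := is_derive_div z1 W s _ _ (Dz1 s) (W_derive s) HW0).
change (is_derive S s ((k s * x1 s * W s - z1 s *
  (w s * x1 s * (- 2 * tau * x1 s * x1 s - w s * (k s * z1 s)) / W s)) / (W s) ^ 2)) in D.
match type of D with is_derive _ _ ?l => replace (2 * x1 s * (x1 s / W s + lambda)) with l end;
  [exact D | ].
assert (Hk : k s * (1 + w s * w s) =
  2 * (W s * W s) * (x1 s + lambda * W s) - 2 * tau * w s * z1 s * (x1 s * x1 s)).
{ unfold k, profile_curvature. fold (W s). field. nra. }
assert (Has := Ha s). clear D HW0.
generalize dependent (W s). generalize dependent (k s). generalize dependent (z1 s).
generalize (w s) (x1 s). clear.
intros v a d Ha k W HW1 HW Hk.
apply Rmult_eq_reg_l with (W * W * W); [ | assert (0 < W * W * W) by nra; lra].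
transitivity (a * (k * (W * W) + v * d * (2 * tau * (a * a) + v * k * d))).
- field. lra.
- transitivity (a * (k * (1 + v * v * (a * a + d * d)) + 2 * tau * v * d * (a * a))).
  + rewrite HW. ring.
  + rewrite Ha. transitivity (a * (k * (1 + v * v) + 2 * tau * v * d * (a * a))); [ring | ].
    rewrite Hk. field. lra.
Qed.

Lemma S_bound s : -1 <= S s <= 1.
Proof.
unfold S, flux_slope. assert (HW1 := W_ge1 s). specialize (Ha s).
assert (Hz : -1 <= z1 s <= 1) by nra.
split.
- apply Rmult_le_reg_r with (W s); [lra | ].
  unfold Rdiv. rewrite Rmult_assoc, Rinv_l by lra. lra.
- apply Rmult_le_reg_r with (W s); [lra | ].
  unfold Rdiv. rewrite Rmult_assoc, Rinv_l by lra. lra.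
Qed.

Lemma one_minus_S_sq s : (1 - S s * S s) * (W s * W s) = x1 s * x1 s * (1 + w s * w s).
Proof.
unfold S, flux_slope. assert (HW1 := W_ge1 s).
transitivity (W s * W s - z1 s * z1 s); [field; lra | ].
rewrite W_sq. specialize (Ha s). nra.
Qed.

Let Q s := S s - 2 * lambda * x s.

Lemma Q_derive s : is_derive Q s (2 * (x1 s * x1 s) / W s).
Proof.
assert (HW1 := W_ge1 s).
replace (2 * (x1 s * x1 s) / W s) with
  (2 * x1 s * (x1 s / W s + lambda) - 2 * lambda * x1 s) by (field; lra).
apply (is_derive_minus (V := R_NormedModule) S (fun s => 2 * lambda * x s)).
- apply S_derive.
- apply is_derive_scal, Dx.
Qed.

Lemma Q_derive_ge0 s : 0 <= 2 * (x1 s * x1 s) / W s.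
Proof. assert (HW1 := W_ge1 s). apply Rdiv_le_0_compat; nra. Qed.

Lemma Q_nondecreasing a b : a <= b -> Q a <= Q b.
Proof.
intros Hab. apply (nondecreasing_of_derive Q (fun s => 2 * (x1 s * x1 s) / W s) a b Hab).
- intros; apply Q_derive.
- intros; apply Q_derive_ge0.
Qed.

Lemma x1_continuity : continuity x1.
Proof. intros s. eapply is_derive_continuity, Dx1. Qed.

Lemma x1_bound s : -1 <= x1 s <= 1.
Proof. specialize (Ha s). nra. Qed.

Lemma w_bounded A : exists M, 0 <= M /\ forall s, Rabs (x s) <= A -> Rabs (w s) <= M.
Proof.
exists (Rabs c + 2 * Rabs tau * Rabs A). split.
- assert (H1 := Rabs_pos c). assert (H2 := Rabs_pos tau). assert (H3 := Rabs_pos A). nra.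
- intros s Hs. unfold w, Rminus.
  eapply Rle_trans; [apply Rabs_triang | ]. rewrite Rabs_Ropp, !Rabs_mult.
  rewrite (Rabs_pos_eq 2) by lra.
  apply Rplus_le_compat_l, Rmult_le_compat_l.
  + assert (H2 := Rabs_pos tau). lra.
  + eapply Rle_trans; [exact Hs | apply Rle_abs].
Qed.

(* [e * asin S + 2 e x] grows at least linearly as long as [x'] keeps the sign of
   [e] and [w] stays bounded. *)
Lemma no_bounded_tail (e A T : R) :
  (e = 1 \/ e = -1) -> (forall s, T <= s -> 0 < e * x1 s) ->
  ~ (forall s, T <= s -> Rabs (x s) <= A).
Proof.
intros He Hpos Hb.
destruct (w_bounded A) as [M [HM Hw]].
set (c0 := 2 * lambda / (1 + M)).
assert (Hc0 : 0 < c0) by (apply Rdiv_lt_0_compat; lra).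
assert (HA : 0 <= A) by (eapply Rle_trans; [apply Rabs_pos | apply (Hb T); lra]).
set (r := fun s => sqrt (1 + w s * w s)).
assert (Hr : forall s, T <= s -> 1 <= r s <= 1 + M /\ r s * r s = 1 + w s * w s).
{ intros s Hs. unfold r. assert (Hws := Hw s (Hb s Hs)). apply Rabs_le_between in Hws.
  split; [split | ].
  - rewrite <- sqrt_1 at 1. apply sqrt_le_1_alt. nra.
  - rewrite <- (sqrt_square (1 + M)) by lra. apply sqrt_le_1_alt. nra.
  - apply sqrt_sqrt. nra. }
assert (Hee : e * e = 1) by (destruct He; subst e; ring).
assert (Hroot : forall s, T <= s ->
  -1 < S s < 1 /\ sqrt (1 - S s * S s) = e * x1 s * r s / W s).
{ intros s Hs. destruct (Hr s Hs) as [Hr1 Hr2]. assert (HW1 := W_ge1 s).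
  assert (Hp := Hpos s Hs). assert (HS := one_minus_S_sq s).
  assert (H0 : 0 < e * x1 s * r s / W s).
  { apply Rdiv_lt_0_compat; [ | lra]. apply Rmult_lt_0_compat; lra. }
  assert (HE : 1 - S s * S s = (e * x1 s * r s / W s) * (e * x1 s * r s / W s)).
  { apply Rmult_eq_reg_r with (W s * W s); [ | nra]. rewrite HS.
    transitivity ((e * e) * (x1 s * x1 s) * (r s * r s)); [rewrite Hee, Hr2; ring | ].
    field. lra. }
  split.
  - assert (0 < 1 - S s * S s) by (rewrite HE; nra). nra.
  - rewrite HE. apply sqrt_square. lra. }
(* Between two times e * asin S varies by at most PI and 2 e x by at most 4 A, whereas growth at
   rate c0 up to T' would amount to one more. *)
set (T' := T + (PI + 4 * A + 1) / c0).
assert (HT' : T <= T').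
{ unfold T'. assert (0 <= (PI + 4 * A + 1) / c0); [ | lra].
  apply Rdiv_le_0_compat; [ | lra]. assert (HPI := PI_RGT_0). lra. }
set (df := fun s => e * (2 * x1 s * (x1 s / W s + lambda) / sqrt (1 - S s * S s))
  - c0 + 2 * e * x1 s).
assert (H : e * asin (S T) - c0 * T + 2 * e * x T
         <= e * asin (S T') - c0 * T' + 2 * e * x T').
{ apply (nondecreasing_of_derive (fun s => e * asin (S s) - c0 * s + 2 * e * x s)
    df T T' HT').
  - intros s Hs. destruct (Hroot s) as [HS Hsq]; [lra | ].
    assert (DA : is_derive asin (S s) (/ sqrt (1 - S s * S s))).
    { apply is_derive_Reals.
      apply (derive_pt_eq_1 asin (S s) _ (derivable_pt_asin (S s) HS)).
      rewrite derive_pt_asin. unfold Rdiv, Rsqr. ring. }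
    assert (DS := is_derive_comp asin S s _ _ DA (S_derive s)).
    change (is_derive (fun s => asin (S s)) s
      ((2 * x1 s * (x1 s / W s + lambda)) * / sqrt (1 - S s * S s))) in DS.
    unfold df.
    apply (is_derive_plus (V := R_NormedModule) (fun s => e * asin (S s) - c0 * s)
      (fun s => 2 * e * x s)).
    + apply (is_derive_minus (V := R_NormedModule) (fun s => e * asin (S s))
        (fun s => c0 * s)).
      * apply is_derive_scal, DS.
      * auto_derive; [exact I | ring].
    + apply is_derive_scal, Dx.
  - intros s Hs. destruct (Hroot s) as [HS Hsq]; [lra | ].
    destruct (Hr s) as [Hr1 Hr2]; [lra | ]. assert (HW1 := W_ge1 s).
    assert (Hp := Hpos s (proj1 Hs)). unfold df. rewrite Hsq.
    assert (Hx0 : x1 s <> 0) by (intros E; rewrite E in Hp; lra).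
    assert (He0 : e <> 0) by (intros E; rewrite E in Hee; lra).
    replace (e * (2 * x1 s * (x1 s / W s + lambda) / (e * x1 s * r s / W s)))
      with (2 * x1 s / r s + 2 * lambda * W s / r s) by (field; repeat split; lra).
    assert (H1 : c0 <= 2 * lambda * W s / r s).
    { unfold c0. apply Rmult_le_reg_r with ((1 + M) * r s); [nra | ].
      replace (2 * lambda / (1 + M) * ((1 + M) * r s)) with (2 * lambda * r s)
        by (field; lra).
      replace (2 * lambda * W s / r s * ((1 + M) * r s)) with (2 * lambda * (W s * (1 + M)))
        by (field; lra).
      apply Rmult_le_compat_l; nra. }
    (* The first term is negative when e = -1; the summand 2 e x was added because its derivative 2
       |x'| outweighs it, as r >= 1. *)
    assert (H2 : 0 <= 2 * x1 s / r s + 2 * e * x1 s).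
    { apply Rmult_le_reg_r with (r s); [lra | ].
      replace ((2 * x1 s / r s + 2 * e * x1 s) * r s) with (2 * x1 s + 2 * (e * x1 s) * r s)
        by (field; lra).
      assert (x1 s = e * (e * x1 s)) by (rewrite <- Rmult_assoc, Hee; ring).
      destruct He; subst e; nra. }
    lra. }
assert (HbT := Hb T (Rle_refl T)). assert (HbT' := Hb T' HT').
apply Rabs_le_between in HbT. apply Rabs_le_between in HbT'.
assert (HaT := asin_bound (S T)). assert (HaT' := asin_bound (S T')).
assert (HE : c0 * (T' - T) = PI + 4 * A + 1) by (unfold T'; field; lra).
assert (Hc : c0 * T' = c0 * T + (PI + 4 * A + 1)) by lra.
destruct He; subst e; lra.
Qed.

(** Suppose that x' has a constant sign e from T0 on. As Q increases and S <= 1, x is bounded above.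
    It is also bounded below: this is clear if e = 1, while for e = -1 a descent to -oo would make
    |w| >= 2 / lambda, hence |x'| / W <= lambda / 2 and S' <= lambda x', and S would leave [-1, 1].
    A bounded x contradicts [no_bounded_tail]. *)
Lemma vertical_point_exists T : exists s, T < s /\ x1 s = 0.
Proof.
apply NNPP. intros Hno.
assert (Hne : forall s, T < s -> x1 s <> 0).
{ intros s Hs E. apply Hno. now exists s. }
set (T0 := T + 1).
assert (Hsgn : exists e, (e = 1 \/ e = -1) /\ forall s, T0 <= s -> 0 < e * x1 s).
{ assert (H0 : x1 T0 <> 0) by (apply Hne; unfold T0; lra).
  destruct (Rlt_dec 0 (x1 T0)) as [Hp | Hp].
  - exists 1. split; [now left | ]. intros s Hs. rewrite Rmult_1_l.
    apply Rnot_le_lt. intros Hle.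
    assert (x1 s <> 0) by (apply Hne; unfold T0 in *; lra).
    destruct (IVT_zero x1 T0 s x1_continuity Hs Hp) as [r [Hr E]]; [lra | ].
    apply (Hne r); [unfold T0 in *; lra | exact E].
  - exists (-1). split; [now right | ]. intros s Hs.
    assert (x1 s <> 0) by (apply Hne; unfold T0 in *; lra).
    apply Rnot_le_lt. intros Hle.
    destruct (IVT_zero (fun s => - x1 s) T0 s) as [r [Hr E]]; try lra.
    + apply continuity_opp, x1_continuity.
    + apply (Hne r); [unfold T0 in *; lra | lra]. }
destruct Hsgn as [e [He Hpos]].
assert (HQ : forall s, T0 <= s -> 2 * lambda * x s <= 1 - Q T0).
{ intros s Hs. assert (H := Q_nondecreasing T0 s Hs). assert (HS := S_bound s).
  unfold Q in H at 2. lra. }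
assert (Hup : forall s, T0 <= s -> x s <= (1 - Q T0) / (2 * lambda)).
{ intros s Hs. specialize (HQ s Hs).
  apply Rmult_le_reg_l with (2 * lambda); [lra | ].
  replace (2 * lambda * ((1 - Q T0) / (2 * lambda))) with (1 - Q T0) by (field; lra). lra. }
assert (Hlow : exists m, forall s, T0 <= s -> m <= x s).
{ destruct He as [-> | ->].
  - exists (x T0). intros s Hs.
    apply (nondecreasing_of_derive x x1 T0 s Hs); [intros; apply Dx | ].
    intros r Hr. specialize (Hpos r (proj1 Hr)). lra.
  - assert (Hmono : forall a b, T0 <= a -> a <= b -> x b <= x a).
    { intros a b H0 Hab.
      assert (- x a <= - x b); [ | lra].
      apply (nondecreasing_of_derive (fun s => - x s) (fun s => - x1 s) a b Hab).
      - intros. apply (is_derive_opp (V := R_NormedModule)), Dx.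
      - intros r Hr. assert (0 < -1 * x1 r) by (apply Hpos; lra). lra. }
    apply NNPP. intros Hunb.
    assert (Hlt : forall m, exists s, T0 <= s /\ x s < m).
    { intros m. apply NNPP. intros H. apply Hunb. exists m. intros s Hs.
      apply Rnot_lt_le. intros Hm. apply H. now exists s. }
    assert (Htau : 0 < Rabs tau) by now apply Rabs_pos_lt.
    set (m := - ((2 / lambda + Rabs c) / (2 * Rabs tau))).
    destruct (Hlt m) as [t [Ht Hxt]].
    assert (Hwbig : forall s, t <= s -> 2 / lambda <= Rabs (w s)).
    { intros s Hs. assert (Hxs := Hmono t s Ht Hs).
      assert (H1 : 2 / lambda + Rabs c <= 2 * Rabs tau * Rabs (x s)).
      { replace (2 / lambda + Rabs c) with
          (2 * Rabs tau * ((2 / lambda + Rabs c) / (2 * Rabs tau))) by (field; lra).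
        apply Rmult_le_compat_l; [lra | ]. unfold m in Hxt.
        assert (H := Rle_abs (- x s)). rewrite Rabs_Ropp in H. lra. }
      replace (2 * Rabs tau * Rabs (x s)) with (Rabs (2 * tau * x s)) in H1
        by (rewrite !Rabs_mult, (Rabs_pos_eq 2) by lra; ring).
      assert (H2 : Rabs (2 * tau * x s) <= Rabs c + Rabs (w s)); [ | lra].
      replace (2 * tau * x s) with (c + - w s) by (unfold w; ring).
      eapply Rle_trans; [apply Rabs_triang | ]. rewrite Rabs_Ropp. lra. }
    (* A further descent of x by more than 2 / lambda makes S drop by more than 2, the length of its
       range. *)
    destruct (Hlt (x t - 2 / lambda)) as [t' [Ht' Hxt']].
    assert (Hl2 : 0 < 2 / lambda) by (apply Rdiv_lt_0_compat; lra).
    assert (Htt' : t <= t').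
    { apply Rnot_lt_le. intros H. assert (x t <= x t') by (apply Hmono; lra). lra. }
    assert (H : lambda * x t - S t <= lambda * x t' - S t').
    { apply (nondecreasing_of_derive (fun s => lambda * x s - S s)
        (fun s => lambda * x1 s - 2 * x1 s * (x1 s / W s + lambda)) t t' Htt').
      - intros s Hs. apply (is_derive_minus (V := R_NormedModule) (fun s => lambda * x s) S).
        + apply is_derive_scal, Dx.
        + apply S_derive.
      - intros s Hs. assert (HW1 := W_ge1 s). assert (HW := W_sq s).
        assert (Hx : x1 s < 0) by (assert (0 < -1 * x1 s) by (apply Hpos; lra); lra).
        assert (Hws := Hwbig s (proj1 Hs)).
        assert (HwW : Rabs (w s) * - x1 s <= W s).
        { rewrite <- (Rabs_pos_eq (W s)) by lra.
          rewrite <- (Rabs_left (x1 s)) by lra. rewrite <- Rabs_mult.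
          apply Rsqr_le_abs_0. unfold Rsqr. rewrite HW. lra. }
        assert (H1 : 2 / lambda * - x1 s <= W s).
        { eapply Rle_trans; [ | exact HwW]. apply Rmult_le_compat_r; lra. }
        assert (H2 : - (lambda / 2) <= x1 s / W s).
        { apply Rmult_le_reg_r with (2 / lambda * W s); [nra | ].
          replace (- (lambda / 2) * (2 / lambda * W s)) with (- W s) by (field; lra).
          replace (x1 s / W s * (2 / lambda * W s)) with (- (2 / lambda * - x1 s))
            by (field; lra). lra. }
        replace (lambda * x1 s - 2 * x1 s * (x1 s / W s + lambda)) with
          (- x1 s * (2 * (x1 s / W s) + lambda)) by ring.
        apply Rmult_le_pos; lra. }
    assert (HS := S_bound t). assert (HS' := S_bound t').
    assert (lambda * x t' < lambda * (x t - 2 / lambda)) by (apply Rmult_lt_compat_l; lra).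
    replace (lambda * (x t - 2 / lambda)) with (lambda * x t - 2) in * by (field; lra).
    lra. }
destruct Hlow as [m Hm].
set (U := (1 - Q T0) / (2 * lambda)) in *.
apply (no_bounded_tail e (Rabs m + Rabs U) T0 He Hpos).
intros s Hs. specialize (Hm s Hs). specialize (Hup s Hs).
assert (H1 := Rle_abs U). assert (H2 := Rle_abs (- m)). rewrite Rabs_Ropp in H2.
assert (H3 := Rabs_pos U). assert (H4 := Rabs_pos m).
apply Rabs_le. lra.
Qed.

(** An arc between consecutive vertical points, with e the sign of x' on it. The curvature is
    positive at both ends, which forces z' to go from -e to e. *)
Let phase (e a b : R) : Prop :=
  a < b /\ x1 a = 0 /\ z1 a = - e /\ x1 b = 0 /\ z1 b = e /\
  forall s, a < s < b -> 0 < e * x1 s.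

(** At a vertical point W = 1 and the curvature reduces to 2 lambda / (1 + w^2) > 0, so the tangent
    always crosses the vertical in the same sense. *)
Lemma vertical_derive e r : x1 r = 0 -> z1 r = - e -> e * e = 1 ->
  exists l, 0 < l /\ is_derive (fun s => e * x1 s) r l.
Proof.
intros Hx Hz He. exists (k r). split.
- unfold k, profile_curvature. fold (W r).
  assert (HW : W r * W r = 1) by (rewrite W_sq, Hx; ring). assert (HW1 := W_ge1 r).
  rewrite HW, Hx. apply Rmult_lt_0_compat.
  + assert (0 < lambda * W r) by (apply Rmult_lt_0_compat; lra). lra.
  + apply Rinv_0_lt_compat. nra.
- replace (k r) with (e * (- k r * z1 r))
    by (rewrite Hz; transitivity ((e * e) * k r); [ring | rewrite He; ring]).
  apply is_derive_scal, Dx1.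
Qed.

Lemma next_phase e a : (e = 1 \/ e = -1) -> x1 a = 0 -> z1 a = - e ->
  exists b, phase e a b.
Proof.
intros He Hx Hz.
assert (Hee : e * e = 1) by (destruct He; subst e; ring).
destruct (vertical_derive e a Hx Hz Hee) as [l [Hl Dl]].
destruct (is_derive_pos_local _ _ _ Dl Hl) as [d [Hd [Hr _]]].
(* As e x' vanishes at a itself, the next zero is sought from a + d/2, where e x' is already
   positive. *)
destruct (vertical_point_exists (a + d / 2)) as [t [Ht Ext]].
assert (Hc : continuity (fun s => e * x1 s)).
{ apply (continuity_mult (fun _ => e) x1); [now apply continuity_const | ].
  apply x1_continuity. }
assert (Hp : forall y, a < y < a + d -> 0 < e * x1 y).
{ intros y Hy. specialize (Hr y Hy). rewrite Hx in Hr. lra. }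
destruct (first_zero (fun s => e * x1 s) (a + d / 2) t) as [b [Hb [Eb Hpos]]];
  try assumption.
- apply Hp. lra.
- cbv beta. rewrite Ext. ring.
- assert (Exb : x1 b = 0).
  { apply Rmult_integral in Eb. destruct Eb as [E | E]; [ | exact E].
    rewrite E in Hee. lra. }
  assert (Hall : forall s, a < s < b -> 0 < e * x1 s).
  { intros s Hs. destruct (Rlt_dec s (a + d / 2)); [apply Hp | apply Hpos]; lra. }
  exists b. repeat split; auto; try lra.
  specialize (Ha b) as Hab. rewrite Exb in Hab.
  assert (Hz2 : (z1 b - e) * (z1 b + e) = 0).
  { transitivity (0 * 0 + z1 b * z1 b - e * e); [ring | rewrite Hab, Hee; ring]. }
  apply Rmult_integral in Hz2. destruct Hz2 as [E | E]; [lra | exfalso].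
  (* If z' were again -e at b, then e x' would increase to 0 there and be negative just before b,
     against its sign on the arc. *)
  destruct (vertical_derive e b Exb) as [l' [Hl' Dl']]; [lra | exact Hee | ].
  destruct (is_derive_pos_local _ _ _ Dl' Hl') as [d' [Hd' [_ Hlf]]].
  assert (Hm1 := Rmax_l a (b - d')). assert (Hm2 := Rmax_r a (b - d')).
  assert (Hm3 : Rmax a (b - d') < b) by (apply Rmax_lub_lt; lra).
  set (y := (Rmax a (b - d') + b) / 2).
  assert (H1 : 0 < e * x1 y) by (apply Hall; unfold y; lra).
  assert (H2 : e * x1 y < e * x1 b) by (apply Hlf; unfold y; lra).
  rewrite Exb in H2. lra.
Qed.

Lemma phase_exists e T : (e = 1 \/ e = -1) -> exists a, T < a /\ x1 a = 0 /\ z1 a = - e.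
Proof.
intros He. destruct (vertical_point_exists T) as [s [Hs Ex]].
specialize (Ha s) as Has. rewrite Ex in Has.
assert (Hz2 : (z1 s - e) * (z1 s + e) = 0) by (destruct He; subst e; lra).
apply Rmult_integral in Hz2. destruct Hz2 as [E | E].
- destruct (next_phase (- e) s) as [b [Hb [_ [_ [Exb [Ezb _]]]]]].
  + destruct He; subst e; lra.
  + exact Ex.
  + lra.
  + exists b. repeat split; auto; lra.
- exists s. repeat split; auto; lra.
Qed.

Lemma phase_Q e a b : phase e a b -> Q a < Q b.
Proof.
intros [Hab [_ [_ [_ [_ Hpos]]]]].
apply (increasing_of_derive Q (fun s => 2 * (x1 s * x1 s) / W s) a b Hab).
- intros; apply Q_derive.
- intros s Hs. assert (HW1 := W_ge1 s). specialize (Hpos s Hs).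
  assert (x1 s <> 0) by (intros E; rewrite E in Hpos; lra).
  apply Rdiv_lt_0_compat; nra.
Qed.

Lemma phase_x e a b : phase e a b ->
  forall s t, a <= s -> s < t -> t <= b -> e * x s < e * x t.
Proof.
intros [Hab [_ [_ [_ [_ Hpos]]]]] s t Hs Hst Ht.
apply (increasing_of_derive (fun s => e * x s) (fun s => e * x1 s) s t Hst).
- intros; apply is_derive_scal, Dx.
- intros r Hr. apply Hpos. lra.
Qed.

Lemma vertical_S s : x1 s = 0 -> S s = z1 s.
Proof.
intros E. unfold S, flux_slope.
assert (HW : W s * W s = 1) by (rewrite W_sq, E; ring). assert (HW1 := W_ge1 s).
replace (W s) with 1 by nra. field.
Qed.

(* While [w] is bounded, [(S - S^3/3)'] is dominated by a multiple of [Q'], so that each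
   phase, along which [S - S^3/3] varies by [4/3], increases [Q] by a fixed amount. *)
Lemma Q_unbounded T B : exists s, T < s /\ B < Q s.
Proof.
apply NNPP. intros Hno.
assert (HQB : forall s, T < s -> Q s <= B).
{ intros s Hs. apply Rnot_lt_le. intros H. apply Hno. now exists s. }
set (T0 := T + 1).
assert (Hx : forall s, T0 <= s -> Q T0 <= S s - 2 * lambda * x s <= B).
{ intros s Hs. split; [now apply Q_nondecreasing | apply HQB; unfold T0 in *; lra]. }
set (A := (1 + Rabs (Q T0) + Rabs B) / (2 * lambda)).
assert (Hxb : forall s, T0 <= s -> Rabs (x s) <= A).
{ intros s Hs. specialize (Hx s Hs). assert (HS := S_bound s).
  assert (H1 := Rle_abs B). assert (H2 := Rle_abs (- Q T0)). rewrite Rabs_Ropp in H2.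
  assert (H3 := Rabs_pos B). assert (H4 := Rabs_pos (Q T0)).
  apply Rmult_le_reg_l with (2 * lambda); [lra | ].
  replace (2 * lambda * A) with (1 + Rabs (Q T0) + Rabs B) by (unfold A; field; lra).
  rewrite <- (Rabs_pos_eq (2 * lambda)) by lra. rewrite <- Rabs_mult.
  apply Rabs_le. lra. }
destruct (w_bounded A) as [M [HM Hw]].
(* 1 + lambda bounds x'/W + lambda, and 1 + M^2 bounds (1 + w^2) / W. *)
set (C := (1 + lambda) * (1 + M * M)).
assert (HC : 0 < C) by (unfold C; nra).
assert (Hdom : forall e a b, (e = 1 \/ e = -1) -> T0 <= a -> a <= b ->
  C * Q a - e * (S a - S a * S a * S a / 3) <= C * Q b - e * (S b - S b * S b * S b / 3)).
{ intros e a b He HTa Hab.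
  apply (nondecreasing_of_derive (fun s => C * Q s - e * (S s - S s * S s * S s / 3))
    (fun s => C * (2 * (x1 s * x1 s) / W s)
      - e * ((1 - S s * S s) * (2 * x1 s * (x1 s / W s + lambda)))) a b Hab).
  - intros s Hs. auto_derive.
    + repeat split; eexists; [apply Q_derive | apply S_derive ..].
    + rewrite (Derive_eta Q s _ (Q_derive s)), (Derive_eta S s _ (S_derive s)). field.
      assert (HW1 := W_ge1 s). lra.
  - intros s Hs. assert (HW1 := W_ge1 s). assert (HS := one_minus_S_sq s).
    assert (Hws := Hw s (Hxb s (Rle_trans _ _ _ HTa (proj1 Hs)))).
    apply Rabs_le_between in Hws. assert (Hx1 := x1_bound s).
    assert (HE : (1 - S s * S s) = x1 s * x1 s * (1 + w s * w s) / (W s * W s)).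
    { rewrite <- HS. field. lra. }
    rewrite HE.
    replace (C * (2 * (x1 s * x1 s) / W s) - e * (x1 s * x1 s * (1 + w s * w s) / (W s * W s)
       * (2 * x1 s * (x1 s / W s + lambda)))) with
      (2 * (x1 s * x1 s) / W s * (C - (e * x1 s) * ((x1 s / W s + lambda) *
        ((1 + w s * w s) / W s)))) by (field; lra).
    apply Rmult_le_pos; [apply Q_derive_ge0 | ].
    assert (Hi : 0 < / W s <= 1).
    { split; [apply Rinv_0_lt_compat; lra | ].
      rewrite <- Rinv_1. apply Rinv_le_contravar; lra. }
    assert (H1 : Rabs (e * x1 s) <= 1) by (destruct He; subst e; apply Rabs_le; lra).
    assert (H2 : Rabs (x1 s / W s + lambda) <= 1 + lambda).
    { apply Rabs_le. unfold Rdiv. nra. }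
    assert (H3 : Rabs ((1 + w s * w s) / W s) <= 1 + M * M).
    { assert (H4 : 1 <= 1 + w s * w s <= 1 + M * M) by nra.
      rewrite Rabs_pos_eq by (apply Rdiv_le_0_compat; lra).
      unfold Rdiv. nra. }
    assert (H5 : Rabs ((e * x1 s) * ((x1 s / W s + lambda) * ((1 + w s * w s) / W s)))
      <= 1 * C).
    { rewrite !Rabs_mult. unfold C. rewrite <- (Rabs_mult e).
      apply Rmult_le_compat; auto using Rabs_pos.
      - apply Rmult_le_pos; apply Rabs_pos.
      - apply Rmult_le_compat; auto using Rabs_pos. }
    apply Rabs_le_between in H5. lra. }
assert (Hstep : forall n, exists e s, (e = 1 \/ e = -1) /\ T0 <= s /\ x1 s = 0 /\ z1 s = - e /\
  C * Q T0 + INR n <= C * Q s).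
{ induction n as [ | n [e [s [He [Hs [Ex [Ez HQ]]]]]]].
  - destruct (phase_exists 1 T0) as [s [Hs [Ex Ez]]]; [now left | ].
    exists 1, s. repeat split; auto; try lra.
    simpl. rewrite Rplus_0_r. apply Rmult_le_compat_l; [lra | ]. apply Q_nondecreasing. lra.
  - destruct (next_phase e s He Ex Ez) as [b [Hb [_ [_ [Exb [Ezb _]]]]]].
    exists (- e), b. split; [destruct He; subst e; lra | ]. repeat split; auto; try lra.
    (* S goes from -e to e, so C Q gains at least 4/3 on this phase; a gain of 1 is recorded, in
       order to count with [INR]. *)
    assert (H := Hdom e s b He Hs (Rlt_le _ _ Hb)).
    rewrite (vertical_S s Ex), (vertical_S b Exb), Ez, Ezb in H.
    rewrite S_INR. destruct He; subst e; lra. }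
destruct (INR_unbounded (C * B - C * Q T0)) as [n Hn].
destruct (Hstep n) as [e [s [_ [Hs [_ [_ HQ]]]]]].
assert (C * Q s <= C * B) by (apply Rmult_le_compat_l; [lra | apply HQB; unfold T0 in *; lra]).
lra.
Qed.

Lemma locally_injective s : exists d, 0 < d /\ forall u v,
  Rabs (u - s) < d -> Rabs (v - s) < d -> x u = x v -> z u = z v -> u = v.
Proof.
assert (Hgen : forall f f1, (forall s, is_derive f s (f1 s)) -> continuity_pt f1 s ->
  f1 s <> 0 -> exists d, 0 < d /\ forall u v,
  Rabs (u - s) < d -> Rabs (v - s) < d -> f u = f v -> u = v).
{ intros f f1 Df Cf Hf.
  destruct (continuity_pt_eps f1 s (Rabs (f1 s)) Cf (Rabs_pos_lt _ Hf)) as [d [Hd Hc]].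
  assert (Hne : forall r, Rabs (r - s) < d -> f1 r <> 0).
  { intros r Hr E. specialize (Hc r Hr). rewrite E, Rminus_0_l, Rabs_Ropp in Hc. lra. }
  assert (Hlt : forall u v, u < v -> Rabs (u - s) < d -> Rabs (v - s) < d -> f u <> f v).
  { intros u v Huv Hu Hv E.
    destruct (MVT_cor2 f f1 u v Huv) as [r [Hr1 Hr2]].
    - intros r _. apply is_derive_Reals, Df.
    - rewrite E, Rminus_diag in Hr1. symmetry in Hr1.
      apply Rmult_integral in Hr1. destruct Hr1 as [H | H]; [ | lra].
      apply (Hne r); [ | exact H]. apply Rabs_def2 in Hu. apply Rabs_def2 in Hv.
      apply Rabs_def1; lra. }
  exists d. split; [exact Hd | ]. intros u v Hu Hv E.
  destruct (Rtotal_order u v) as [H | [H | H]]; [ | exact H | ]; exfalso.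
  - now apply (Hlt u v).
  - now apply (Hlt v u). }
destruct (Req_dec (x1 s) 0) as [E | E].
- assert (Hz : z1 s <> 0).
  { intros E'. specialize (Ha s). rewrite E, E' in Ha. lra. }
  destruct (Hgen z z1 Dz (is_derive_continuity _ _ _ (Dz1 s)) Hz) as [d [Hd H]].
  exists d. split; auto.
- destruct (Hgen x x1 Dx (x1_continuity s) E) as [d [Hd H]].
  exists d. split; auto.
Qed.

Theorem profile_loops_pos T X0 : exists a b, T < a /\ a < b /\ x a = x b /\ z a = z b /\
  (forall u v, a <= u < b -> a <= v < b -> x u = x v -> z u = z v -> u = v) /\ x a < X0.
Proof.
(* Beyond T' the inequality Q > 1 - 2 lambda X0 persists and, since S <= 1, it forces x < X0. *)
destruct (Q_unbounded T (1 - 2 * lambda * X0)) as [T' [HT' HQ]].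
destruct (phase_exists (-1) T') as [s1 [Hs1 [Ex1 Ez1]]]; [now right | ].
destruct (next_phase (-1) s1) as [s2 P1]; [now right | assumption | assumption | ].
assert (P1' := P1). destruct P1' as [H12 [_ [_ [Ex2 [Ez2 _]]]]].
destruct (next_phase 1 s2) as [s3 P2]; [now left | assumption | lra | ].
assert (P2' := P2). destruct P2' as [H23 [_ [_ [Ex3 [Ez3 _]]]]].
destruct (next_phase (-1) s3) as [s4 P3]; [now right | assumption | lra | ].
assert (P3' := P3). destruct P3' as [H34 [_ [_ [Ex4 [Ez4 _]]]]].
assert (Q12 := phase_Q _ _ _ P1). assert (Q23 := phase_Q _ _ _ P2).
assert (Q34 := phase_Q _ _ _ P3).
unfold Q in Q12, Q23, Q34.
rewrite (vertical_S s1 Ex1), (vertical_S s2 Ex2) in Q12.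
rewrite (vertical_S s2 Ex2), (vertical_S s3 Ex3) in Q23.
rewrite (vertical_S s3 Ex3), (vertical_S s4 Ex4) in Q34.
(* S takes the same value 1 at s1 and s3, and -1 at s2 and s4, so an increase of Q is a decrease of
   x. *)
assert (X13 : x s3 < x s1).
{ apply Rmult_lt_reg_l with (2 * lambda); lra. }
assert (X24 : x s4 < x s2).
{ apply Rmult_lt_reg_l with (2 * lambda); lra. }
assert (Cx : continuity x) by (intros s; eapply is_derive_continuity, Dx).
assert (Cz : continuity z) by (intros s; eapply is_derive_continuity, Dz).
(* The first of the three phases has x' < 0, hence -x as abscissa; z' is -1 at s2 and 1 at s3, the
   signs required at the turning points. *)
destruct (zigzag_crossing (fun s => - x s) z s1 s2 s3 s4 (z1 s2) (z1 s3))
  as [a0 [b0 [Ha0 [Hab0 [Hb0 [EX EZ]]]]]]; auto; try lra.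
- now apply continuity_opp.
- intros s t H1 H2 H3. assert (H := phase_x _ _ _ P1 s t H1 H2 H3). lra.
- intros s t H1 H2 H3. assert (H := phase_x _ _ _ P2 s t H1 H2 H3). lra.
- intros s t H1 H2 H3. assert (H := phase_x _ _ _ P3 s t H1 H2 H3). lra.
- destruct (simple_loop x z s1 a0 b0 Cx Cz locally_injective Ha0 Hab0) as
    [a [b [H1 [H2 [H3 [H4 [H5 H6]]]]]]]; [lra | exact EZ | ].
  exists a, b. repeat split; auto; try lra.
  assert (HQa := Q_nondecreasing T' a). assert (HS := S_bound a).
  assert (HQ' : 1 - 2 * lambda * X0 < S a - 2 * lambda * x a)
    by (eapply Rlt_le_trans; [exact HQ | apply HQa; lra]).
  apply Rmult_lt_reg_l with (2 * lambda); lra.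
Qed.

End Dynamics.

(** The reflection x -> -x exchanges the metrics of parameters tau and -tau. As tau and x change
    sign together, w and W are unchanged, while the curvature of the plane curve changes sign, and
    with it lambda. *)
Lemma profile_reflect tau lambda c x z x1 z1 :
  profile tau lambda c x z x1 z1 ->
  profile (- tau) (- lambda) c (fun s => - x s) z (fun s => - x1 s) z1.
Proof.
intros [Dx Dz Ha Dx1 Dz1].
assert (Hk : forall s, profile_curvature (- tau) (- lambda) (c - 2 * - tau * - x s) (- x1 s) (z1 s)
  = - profile_curvature tau lambda (c - 2 * tau * x s) (x1 s) (z1 s)).
{ intros s. unfold profile_curvature.
  replace (c - 2 * - tau * - x s) with (c - 2 * tau * x s) by ring.
  replace (speed (c - 2 * tau * x s) (- x1 s)) with (speed (c - 2 * tau * x s) (x1 s))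
    by (unfold speed; f_equal; ring).
  ring. }
split; auto.
- intros s. apply (is_derive_opp (V := R_NormedModule)), Dx.
- intros s. rewrite <- (Ha s). ring.
- intros s. rewrite Hk.
  replace (- - profile_curvature tau lambda (c - 2 * tau * x s) (x1 s) (z1 s) * z1 s) with
    (- (- profile_curvature tau lambda (c - 2 * tau * x s) (x1 s) (z1 s) * z1 s)) by ring.
  apply (is_derive_opp (V := R_NormedModule)), Dx1.
- intros s. rewrite Hk.
  replace (- profile_curvature tau lambda (c - 2 * tau * x s) (x1 s) (z1 s) * - x1 s) with
    (profile_curvature tau lambda (c - 2 * tau * x s) (x1 s) (z1 s) * x1 s) by ring.
  apply Dz1.
Qed.

Theorem profile_loops tau lambda c x z x1 z1 :
  tau <> 0 -> lambda <> 0 -> profile tau lambda c x z x1 z1 ->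
  exists e, (e = 1 \/ e = -1) /\ forall T X0, exists a b,
    T < a /\ a < b /\ x a = x b /\ z a = z b /\
    (forall u v, a <= u < b -> a <= v < b -> x u = x v -> z u = z v -> u = v) /\
    e * x a < X0.
Proof.
intros Htau Hl Hp. destruct (Rlt_dec 0 lambda) as [Hpos | Hneg].
- exists 1. split; [now left | ]. intros T X0.
  destruct (profile_loops_pos tau lambda c x z x1 z1 Htau Hpos Hp T X0)
    as [a [b [H1 [H2 [H3 [H4 [H5 H6]]]]]]].
  exists a, b. repeat split; auto. lra.
- exists (-1). split; [now right | ]. intros T X0.
  assert (Hpos : 0 < - lambda) by lra. assert (Htau' : - tau <> 0) by lra.
  destruct (profile_loops_pos _ _ _ _ _ _ _ Htau' Hpos (profile_reflect _ _ _ _ _ _ _ Hp) T X0)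
    as [a [b [H1 [H2 [H3 [H4 [H5 H6]]]]]]].
  exists a, b. repeat split; auto; try lra.
  intros u v Hu Hv Ex Ez. apply H5; auto. lra.
Qed.

(** Each loop is chosen after the end of the previous one, which makes the intervals disjoint, and
    with a smaller value of e x at its start, which makes the crossing points distinct. *)
Lemma infinitely_many_loops (alpha : R -> R3) (x z : R -> R) (e : R) :
  (forall s, alpha s = (x s, 0, z s)) ->
  (forall T X0, exists a b, T < a /\ a < b /\ x a = x b /\ z a = z b /\
    (forall u v, a <= u < b -> a <= v < b -> x u = x v -> z u = z v -> u = v) /\
    e * x a < X0) ->
  loops_infinitely_often alpha /\ self_intersects_infinitely_often alpha.
Proof.
intros Ha Hl.
destruct (functional_choice (fun (p ab : R * R) => is_loop alpha (fst ab) (snd ab) /\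
  snd p < fst ab /\ e * x (fst ab) < e * x (fst p))) as [next Hnext].
{ intros [a0 b0]. destruct (Hl b0 (e * x a0)) as [a [b [H1 [H2 [H3 [H4 [H5 H6]]]]]]].
  exists (a, b). cbn [fst snd]. split; [ | split; assumption].
  split; [exact H2 | split].
  - rewrite !Ha. now rewrite H3, H4.
  - intros u v Hu Hv E. rewrite !Ha in E. injection E. intros. now apply H5. }
(* The sequence starts at [next (0, 0)], since the pair (0, 0) is only a seed and not a loop. *)
set (seq := nat_rect (fun _ => (R * R)%type) (next (0, 0)) (fun _ p => next p)).
assert (Hloop : forall n, is_loop alpha (fst (seq n)) (snd (seq n))).
{ intros [ | n]; simpl; apply Hnext. }
assert (Hlt : forall n, snd (seq n) < fst (seq (S n)) /\
  e * x (fst (seq (S n))) < e * x (fst (seq n))).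
{ intros n. simpl. apply Hnext. }
split.
- exists (fun n => fst (seq n)), (fun n => snd (seq n)). intros n. split; [apply Hloop | apply Hlt].
- exists (fun n => alpha (fst (seq n))). split.
  + assert (Hdec : forall m k, e * x (fst (seq (S k + m)%nat)) < e * x (fst (seq m))).
    { intros m. induction k as [ | k IH].
      - apply Hlt.
      - eapply Rlt_trans; [apply Hlt | exact IH]. }
    assert (Hne : forall m n, (m < n)%nat -> alpha (fst (seq m)) <> alpha (fst (seq n))).
    { intros m n Hmn E. rewrite !Ha in E. injection E. intros _ Ex.
      specialize (Hdec m (n - S m)%nat). replace (S (n - S m) + m)%nat with n in Hdec by lia.
      rewrite Ex in Hdec. lra. }
    intros m n E. destruct (Nat.lt_total m n) as [H | [H | H]]; [ | exact H | ]; exfalso.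
    * now apply (Hne m n).
    * symmetry in E. now apply (Hne n m).
  + intros n. destruct (Hloop n) as [H1 [H2 _]].
    exists (fst (seq n)), (snd (seq n)). repeat split; [lra | now symmetry].
Qed.

(** For lambda = 0 the vertical planes x = const satisfy [grim_reaper], as H and the angle function
    both vanish, and their profiles are straight lines. Hence loops are claimed for lambda <> 0, and
    existence asks for a point at which the angle function is not 0, which excludes these planes. *)
Theorem theorem1p2 : forall tau lambda : R, tau <> 0 ->
  (exists Psi N : R -> surface, forall c : R, 0 <= c ->
     grim_reaper tau lambda c (Psi c) (N c) /\
     exists s t : R, angle_function tau (Psi c) (N c) s t <> 0) /\
  (forall (c : R) (psi N : surface), 0 <= c ->
     grim_reaper tau lambda c psi N ->
     (forall s : R, cy (profile_curve psi s) = 0) /\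
     (lambda <> 0 ->
        loops_infinitely_often (profile_curve psi) /\
        self_intersects_infinitely_often (profile_curve psi))).
Proof.
intros tau lambda Htau. split.
- destruct (grim_reapers_exist tau lambda Htau) as [Psi [N H]].
  exists Psi, N. intros c _. apply H.
- intros c psi N _ Hgr.
  destruct (grim_reaper_profile tau lambda c psi N Hgr)
    as [eps [x [z [x1 [z1 [Heps [Ha Hp]]]]]]].
  split.
  + intros s. now rewrite Ha.
  + intros Hl. assert (Hl' : eps * lambda <> 0) by (destruct Heps; subst eps; lra).
    destruct (profile_loops tau (eps * lambda) c x z x1 z1 Htau Hl' Hp) as [e [_ He]].
    exact (infinitely_many_loops (profile_curve psi) x z e Ha He).
Qed.
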